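(* Let $\Sigma=(\{\square\},\{a,b\})$ and $T=(\Sigma,\{s_1,s_2,s_3,s_4,p_1,p_2,p_3\})$, and let $P_a$ (resp. $P_b$) be the graph consisting of two nodes and a single edge between them labelled $a$ (resp. $b$). Then $(T,\{P_a,P_b\})$ is a backtracking-free specification for the labelled series-parallel graphs over $\Sigma$.
   Context: Graphs over $\Sigma$ are finite directed graphs with all nodes labelled $\square$ and edges labelled $a$ or $b$. Rules $\langle L\leftarrow K\rightarrow R\rangle$ (pairs of inclusions) are applied by double-pushout graph transformation with injective matches; $\Rightarrow^*$ means isomorphic or reachable in one or more steps. In all seven rules the interface $K$ consists of two nodes $1,2$ and no edges, and the right-hand side $R$ is a single edge $1\xrightarrow{a}2$. The left-hand sides are: for $s_1,s_2,s_3,s_4$, a path $1\xrightarrow{x}v\xrightarrow{y}2$ through a third node $v$ with $(x,y)=(a,a),(a,b),(b,a),(b,b)$ respectively; for $p_1,p_2,p_3$, two parallel edges from $1$ to $2$ labelled $\{a,a\}$, $\{a,b\}$, $\{b,b\}$ respectively. Series-parallel graphs are defined inductively: a single edge $s\to t$ is series-parallel with source $s$ and sink $t$; the class is closed under parallel composition (identify the two sources and the two sinks) and sequential composition (identify the sink of one with the source of the other). The labelled series-parallel graphs are the series-parallel graphs with arbitrary edge labels from $\{a,b\}$ (and node label $\square$). $(T,\mathcal{S})$, with $\mathcal{S}$ a finite set of graphs, recognises a language $\mathcal{L}$ over $\Sigma$ if for all graphs $G$ over $\Sigma$, $[G]\in\mathcal{L}$ iff $G\Rightarrow^*S$ for some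 $S\in\mathcal{S}$. It is a backtracking-free specification for $\mathcal{L}$ over $\Sigma$ if it recognises $\mathcal{L}$, $T$ is terminating on all graphs over $\Sigma$, and $T$ is confluent (up to garbage) on $\mathcal{L}$: for all $G\in\mathcal{L}$, $H_1\Leftarrow^*G\Rightarrow^*H_2$ implies $H_1\Rightarrow^*M\Leftarrow^*H_2$ for some $M$. *)

(* Defs.v *)
From Stdlib Require List.
From Stdlib Require Import Relation_Operators.
From HB Require Import structures.
From mathcomp Require Import all_boot.

Set Implicit Arguments.
Unset Strict Implicit.
Unset Printing Implicit Defensive.

Record digraph := Digraph {
  node : finType;
  edge : finType;
  src : edge -> node;
  tgt : edge -> node }.

Record alphabet := Alphabet {
  node_label : finType;
  edge_label : finType }.

Record graph (Sg : alphabet) := Graph {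
  underlying :> digraph;
  nlab : node underlying -> node_label Sg;
  elab : edge underlying -> edge_label Sg }.

Record dmorphism (G H : digraph) := DMorphism {
  fnode : node G -> node H;
  fedge : edge G -> edge H;
  src_morph : forall e, src (fedge e) = fnode (src e);
  tgt_morph : forall e, tgt (fedge e) = fnode (tgt e) }.

Definition dmorph_inj G H (f : dmorphism G H) : Prop :=
  injective (fnode f) /\ injective (fedge f).

Definition dmorph_bij G H (f : dmorphism G H) : Prop :=
  bijective (fnode f) /\ bijective (fedge f).

Definition dmorph_eq G H (f g : dmorphism G H) : Prop :=
  fnode f =1 fnode g /\ fedge f =1 fedge g.

Program Definition dmorph_comp F G H (g : dmorphism G H) (f : dmorphism F G) :
    dmorphism F H :=
  @DMorphism F H (fnode g \o fnode f) (fedge g \o fedge f) _ _.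
Next Obligation. by rewrite !src_morph. Qed.
Next Obligation. by rewrite !tgt_morph. Qed.

Record morphism (Sg : alphabet) (G H : graph Sg) := Morphism {
  dmorph :> dmorphism G H;
  nlab_morph : forall v, nlab (fnode dmorph v) = nlab v;
  elab_morph : forall e, elab (fedge dmorph e) = elab e }.

Definition isomorphic (Sg : alphabet) (G H : graph Sg) : Prop :=
  exists f : morphism G H, dmorph_bij f.

(* The square  A --f--> B
               |        |
               g        h
               v        v
               C --k--> D   is a pushout of graphs over Sg. *)
Definition pushout (Sg : alphabet) (A B C D : graph Sg)
    (f : morphism A B) (g : morphism A C)
    (h : morphism B D) (k : morphism C D) : Prop :=
  dmorph_eq (dmorph_comp h f) (dmorph_comp k g) /\
  forall (X : graph Sg) (h' : morphism B X) (k' : morphism C X),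
    dmorph_eq (dmorph_comp h' f) (dmorph_comp k' g) ->
    exists u : morphism D X,
      [/\ dmorph_eq (dmorph_comp u h) h',
          dmorph_eq (dmorph_comp u k) k' &
          forall u' : morphism D X,
            dmorph_eq (dmorph_comp u' h) h' ->
            dmorph_eq (dmorph_comp u' k) k' -> dmorph_eq u' u].

(* The inclusions of K in L and R are represented by injective morphisms. *)
Record rule (Sg : alphabet) := Rule {
  lhs : graph Sg;
  interface : graph Sg;
  rhs : graph Sg;
  incl_l : morphism interface lhs;
  incl_r : morphism interface rhs;
  incl_l_inj : dmorph_inj incl_l;
  incl_r_inj : dmorph_inj incl_r }.

Definition direct_derivation (Sg : alphabet) (r : rule Sg) (G H : graph Sg) :
    Prop :=
  exists (m : morphism (lhs r) G) (D : graph Sg) (d : morphism (interface r) D)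
         (c : morphism D G) (m' : morphism (rhs r) H) (c' : morphism D H),
    [/\ dmorph_inj m,
        pushout (incl_l r) d m c &
        pushout (incl_r r) d m' c'].

Record system (Sg : alphabet) := System { rules : seq (rule Sg) }.

Definition step (Sg : alphabet) (T : system Sg) (G H : graph Sg) : Prop :=
  exists r, List.In r (rules T) /\ direct_derivation r G H.

Definition derives (Sg : alphabet) (T : system Sg) (G H : graph Sg) : Prop :=
  isomorphic G H \/ clos_trans (graph Sg) (step T) G H.

(* A set of isomorphism classes of graphs, as an isomorphism-closed predicate. *)
Record language (Sg : alphabet) := Language {
  in_lang :> graph Sg -> Prop;
  in_lang_iso : forall G H, isomorphic G H -> in_lang G -> in_lang H }.

Definition recognises (Sg : alphabet) (T : system Sg) (S : seq (graph Sg))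
    (L : language Sg) : Prop :=
  forall G : graph Sg, L G <-> exists P, List.In P S /\ derives T G P.

Definition terminating (Sg : alphabet) (T : system Sg) : Prop :=
  ~ exists G : nat -> graph Sg, forall n, step T (G n) (G n.+1).

Definition confluent_on (Sg : alphabet) (T : system Sg) (L : language Sg) :
    Prop :=
  forall G H1 H2 : graph Sg, L G -> derives T G H1 -> derives T G H2 ->
    exists M, derives T H1 M /\ derives T H2 M.

Definition backtracking_free_specification (Sg : alphabet) (T : system Sg)
    (S : seq (graph Sg)) (L : language Sg) : Prop :=
  [/\ recognises T S L, terminating T & confluent_on T L].

Record two_terminal := TwoTerminal {
  tt_graph :> digraph;
  source : node tt_graph;
  sink : node tt_graph }.

Definition two_terminal_iso (X Y : two_terminal) : Prop :=
  exists f : dmorphism X Y,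
    [/\ dmorph_bij f, fnode f (source X) = source Y & fnode f (sink X) = sink Y].

(* The disjoint union of G and H in which every node y of H satisfying A is
   identified with the node f y of G; f is irrelevant outside A. *)
Section Glue.
Variables (G H : digraph) (A : pred (node H)) (f : node H -> node G).

Definition glue_node : finType := (node G + {y : node H | ~~ A y})%type.

Definition glue_l (x : node G) : glue_node := inl x.

Definition glue_r (y : node H) : glue_node :=
  if insub y is Some u then inr u else inl (f y).

Definition glue : digraph :=
  @Digraph glue_node (edge G + edge H)%type
    (fun e => match e with inl d => glue_l (src d) | inr d => glue_r (src d) end)
    (fun e => match e with inl d => glue_l (tgt d) | inr d => glue_r (tgt d) end).

End Glue.

Definition parallel (X Y : two_terminal) : two_terminal :=
  let A := pred2 (source Y) (sink Y) in
  let f := fun y => if y == source Y then source X else sink X in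
  @TwoTerminal (@glue X Y A f) (glue_l A (source X)) (glue_l A (sink X)).

Definition sequential (X Y : two_terminal) : two_terminal :=
  let A := pred1 (source Y) in
  let f := fun=> sink X in
  @TwoTerminal (@glue X Y A f) (glue_l A (source X)) (glue_r A f (sink Y)).

(* One edge from node false to node true. *)
Definition edge_digraph : digraph :=
  @Digraph bool unit (fun=> false) (fun=> true).

Inductive series_parallel : two_terminal -> Prop :=
| sp_edge : series_parallel (@TwoTerminal edge_digraph false true)
| sp_parallel X Y :
    series_parallel X -> series_parallel Y -> series_parallel (parallel X Y)
| sp_sequential X Y :
    series_parallel X -> series_parallel Y -> series_parallel (sequential X Y)
| sp_iso X Y : two_terminal_iso X Y -> series_parallel X -> series_parallel Y.

Definition labelled_sp (Sg : alphabet) (G : graph Sg) : Prop :=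
  exists s t : node G, series_parallel (TwoTerminal s t).

Lemma labelled_sp_iso (Sg : alphabet) (G H : graph Sg) :
  isomorphic G H -> labelled_sp G -> labelled_sp H.
Proof.
move=> [f f_bij] [s [t spG]]; exists (fnode f s), (fnode f t).
by apply: sp_iso spG; exists f.
Qed.

Definition labelled_series_parallel (Sg : alphabet) : language Sg :=
  Language (@labelled_sp_iso Sg).

Variant ab := lab_a | lab_b.

Definition bool_of_ab (x : ab) : bool := if x is lab_a then false else true.
Definition ab_of_bool (x : bool) : ab := if x then lab_b else lab_a.
Lemma bool_of_abK : cancel bool_of_ab ab_of_bool. Proof. by case. Qed.
HB.instance Definition _ := Finite.copy ab (can_type bool_of_abK).

Definition Sigma : alphabet := @Alphabet unit ab.

Definition ab_graph (G : digraph) (l : edge G -> ab) : graph Sigma :=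
  @Graph Sigma G (fun=> tt) l.

(* Nodes 1 and 2 are false and true in all graphs below; the extra node v of the
   path is None. *)
Definition P_ (x : ab) : graph Sigma := @ab_graph edge_digraph (fun=> x).

Definition two_nodes : graph Sigma :=
  @ab_graph (@Digraph bool void (of_void _) (of_void _)) (of_void _).

Definition path_graph (x y : ab) : graph Sigma :=
  @ab_graph
    (@Digraph (option bool) bool
       (fun e => if e then None else Some false)
       (fun e => if e then Some true else None))
    (fun e => if e then y else x).

Definition parallel_graph (x y : ab) : graph Sigma :=
  @ab_graph (@Digraph bool bool (fun=> false) (fun=> true))
    (fun e => if e then y else x).

Program Definition two_nodes_morphism (G : graph Sigma)
    (h : bool -> node G) : morphism two_nodes G :=
  @Morphism Sigma two_nodes G
    (@DMorphism two_nodes G h (of_void _) _ _) _ _.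
Next Obligation. by case: e. Qed.
Next Obligation. by case: e. Qed.
Next Obligation. by case: (nlab _). Qed.
Next Obligation. by case: e. Qed.

Lemma two_nodes_morphism_inj (G : graph Sigma) (h : bool -> node G) :
  injective h -> dmorph_inj (two_nodes_morphism h).
Proof. by move=> h_inj; split=> // -[]. Qed.

Definition s_rule (x y : ab) : rule Sigma :=
  @Rule Sigma (path_graph x y) two_nodes (P_ lab_a) _ _
    (@two_nodes_morphism_inj (path_graph x y) Some (@Some_inj _))
    (@two_nodes_morphism_inj (P_ lab_a) id (@inj_id bool)).

Definition p_rule (x y : ab) : rule Sigma :=
  @Rule Sigma (parallel_graph x y) two_nodes (P_ lab_a) _ _
    (@two_nodes_morphism_inj (parallel_graph x y) id (@inj_id bool))
    (@two_nodes_morphism_inj (P_ lab_a) id (@inj_id bool)).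

Definition sp_system : system Sigma :=
  System [:: s_rule lab_a lab_a; s_rule lab_a lab_b;
             s_rule lab_b lab_a; s_rule lab_b lab_b;
             p_rule lab_a lab_a; p_rule lab_a lab_b; p_rule lab_b lab_b].

(* Main.v *)
From Stdlib Require Import Relation_Operators.
Require Import Defs.
From mathcomp Require Import all_boot.

(* A series-parallel graph is presented as an edge set S of an ambient graph, with
   source s and sink t.  The essential point is that one reduction step G => H
   preserves membership in the language in both directions: as a subgraph of G, H
   is obtained by deleting one of two parallel edges, or by deleting the first
   edge of a series pair and moving the source of the second.  Forward, induction
   on the presentation only leaves the cases where the redex straddles the two
   parts of a composition; there the redex is a direct edge of a parallel
   composition, or the last edge of the first part of a sequential one, and can
   be split off.  A series-parallel graph with more than one edge has a redex, and
   steps remove one edge and create an a-labelled one.  Hence every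
   series-parallel graph with several edges, and every one reached by a step,
   reduces to P_a, which gives recognition and confluence together. *)

Set Implicit Arguments.
Unset Strict Implicit.
Unset Printing Implicit Defensive.

(** * Series-parallel edge sets *)

Section EdgeSets.
Variables (E : finType) (N : eqType).
Implicit Types (src tgt : E -> N) (S : {set E}) (x s t : N).

Definition incident src tgt S x : bool :=
  [exists e in S, (src e == x) || (tgt e == x)].

Lemma incidentP src tgt S x :
  reflect (exists2 e, e \in S & src e = x \/ tgt e = x)
          (incident src tgt S x).
Proof.
apply: (iffP exists_inP) => -[e eS].
  by case/orP=> /eqP; exists e => //; [left|right].
by move=> ex; exists e => //; case: ex => ->; rewrite eqxx ?orbT.
Qed.

Lemma incident_src src tgt S e : e \in S -> incident src tgt S (src e).
Proof. by move=> eS; apply/incidentP; exists e; auto. Qed.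

Lemma incident_tgt src tgt S e : e \in S -> incident src tgt S (tgt e).
Proof. by move=> eS; apply/incidentP; exists e; auto. Qed.

Lemma incidentS src tgt S S' x :
  S \subset S' -> incident src tgt S x -> incident src tgt S' x.
Proof.
by move=> /subsetP sub /incidentP[e /sub eS ex]; apply/incidentP; exists e.
Qed.

Lemma incidentU src tgt S S' x :
  incident src tgt (S :|: S') x = incident src tgt S x || incident src tgt S' x.
Proof.
apply/idP/orP => [/incidentP[e]|[]]; last 2 first.
- exact/incidentS/subsetUl.
- exact/incidentS/subsetUr.
by rewrite inE => /orP[] eS ex; [left|right]; apply/incidentP; exists e.
Qed.

Lemma incident1 src tgt e x :
  incident src tgt [set e] x = (src e == x) || (tgt e == x).
Proof.
apply/incidentP/orP => [[e' /set1P->]|]; first by case=> ->; [left|right].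
by move=> ex; exists e; [exact: set11|case: ex => /eqP; auto].
Qed.

(* Series-parallel graphs presented as edge sets of one ambient graph: the
   gluings of the two compositions become conditions on which nodes are shared. *)
Inductive sp src tgt : {set E} -> N -> N -> Prop :=
| sp_one e : src e != tgt e -> sp src tgt [set e] (src e) (tgt e)
| sp_par S1 S2 s t :
    sp src tgt S1 s t -> sp src tgt S2 s t ->
    (forall e, e \in S1 -> e \in S2 -> False) ->
    (forall x, incident src tgt S1 x -> incident src tgt S2 x ->
       x = s \/ x = t) ->
    sp src tgt (S1 :|: S2) s t
| sp_seq S1 S2 s c t :
    sp src tgt S1 s c -> sp src tgt S2 c t ->
    (forall e, e \in S1 -> e \in S2 -> False) ->
    (forall x, incident src tgt S1 x -> incident src tgt S2 x -> x = c) ->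
    sp src tgt (S1 :|: S2) s t.

End EdgeSets.

(** * Transport of presentations along maps of nodes and edges *)

Section Transport.
Variables (E1 E2 : finType) (N1 N2 : eqType).
Variables (src1 tgt1 : E1 -> N1) (src2 tgt2 : E2 -> N2).
Variables (fn : N1 -> N2) (fe : E1 -> E2).

Lemma incident_imset (S : {set E1}) y :
  {in S, forall e, src2 (fe e) = fn (src1 e)} ->
  {in S, forall e, tgt2 (fe e) = fn (tgt1 e)} ->
  incident src2 tgt2 (fe @: S) y ->
  exists2 x, incident src1 tgt1 S x & y = fn x.
Proof.
move=> fsrc ftgt /incidentP[_ /imsetP[e eS ->]]; rewrite fsrc // ftgt //.
by case=> <-; [exists (src1 e); first exact: incident_src
              |exists (tgt1 e); first exact: incident_tgt].
Qed.

(** Compatibility and injectivity are asked only on [S] and the nodes it touches, so the lemma also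
    covers partial inverses of embeddings and the renaming of a single node. *)
Lemma sp_imset S s t :
  sp src1 tgt1 S s t ->
  {in S, forall e, src2 (fe e) = fn (src1 e)} ->
  {in S, forall e, tgt2 (fe e) = fn (tgt1 e)} ->
  {in incident src1 tgt1 S &, injective fn} -> {in S &, injective fe} ->
  sp src2 tgt2 (fe @: S) (fn s) (fn t).
Proof.
(* The hypotheses are bundled so that the induction can restrict them to both parts of a
   composition. *)
pose ok (S : {set E1}) :=
  [/\ {in S, forall e, src2 (fe e) = fn (src1 e)},
      {in S, forall e, tgt2 (fe e) = fn (tgt1 e)},
      {in incident src1 tgt1 S &, injective fn} & {in S &, injective fe}].
move=> spS fsrc ftgt fnI feI; have: ok S by [].
have sub (A B : {set E1}) : A \subset B -> ok B -> ok A.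
  move=> AB [srcB tgtB fnB feB]; have /subsetP AB' := AB; split.
  - by move=> e /AB' /srcB.
  - by move=> e /AB' /tgtB.
  - by move=> x y xA yA; apply: fnB; apply: incidentS AB _.
  - by move=> x y /AB' xA /AB' yA; apply: feB.
have disj (A B : {set E1}) : (forall e, e \in A -> e \in B -> False) -> ok (A :|: B) ->
    forall e, e \in fe @: A -> e \in fe @: B -> False.
  move=> dE [_ _ _ feAB] _ /imsetP[e eA ->] /imsetP[e' e'B] /feAB ee'.
  by apply: (dE e) => //; rewrite ee' // inE ?eA ?e'B ?orbT.
have shared (A B : {set E1}) y : ok (A :|: B) ->
    incident src2 tgt2 (fe @: A) y -> incident src2 tgt2 (fe @: B) y ->
    exists x, [/\ incident src1 tgt1 A x, incident src1 tgt1 B x & y = fn x].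
  move=> okAB; have [_ _ fnAB _] := okAB.
  have [srcA tgtA _ _] := sub _ _ (subsetUl A B) okAB.
  have [srcB tgtB _ _] := sub _ _ (subsetUr A B) okAB.
  move=> /(incident_imset srcA tgtA)[x xA ->].
  move=> /(incident_imset srcB tgtB)[x' xB xx']; exists x; split=> //.
  rewrite (fnAB x x') //; first exact: incidentS (subsetUl _ _) xA.
  exact: incidentS (subsetUr _ _) xB.
elim: spS => {S s t fsrc ftgt fnI feI}
  [e st|S1 S2 s t _ IH1 _ IH2 dE dN|S1 S2 s c t _ IH1 _ IH2 dE dN] okS.
- have [fsrc ftgt fnI _] := okS; have ee := set11 e.
  rewrite imset_set1 -fsrc // -ftgt //; apply: sp_one.
  rewrite fsrc // ftgt //; apply: contraNneq st => eq_st.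
  by apply/eqP/fnI => //; [apply: incident_src|apply: incident_tgt].
- have [ok1 ok2] := (sub _ _ (subsetUl S1 S2) okS, sub _ _ (subsetUr S1 S2) okS).
  rewrite imsetU; apply: sp_par; [exact: IH1|exact: IH2|exact: disj|].
  by move=> y /shared h /h[//|x [/dN h' /h' xst ->]]; case: xst => ->; auto.
- have [ok1 ok2] := (sub _ _ (subsetUl S1 S2) okS, sub _ _ (subsetUr S1 S2) okS).
  rewrite imsetU; apply: sp_seq; [exact: IH1|exact: IH2|exact: disj|].
  by move=> y /shared h /h[//|x [/dN h' /h' -> ->]].
Qed.

End Transport.

(** * Terminals of a series-parallel edge set *)

Section SpTheory.
Variables (E : finType) (N : eqType).
Implicit Types (src tgt : E -> N) (S : {set E}) (x s t : N).

Lemma eq_sp src tgt src' S s t :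
  {in S, src =1 src'} -> sp src tgt S s t -> sp src' tgt S s t.
Proof.
move=> eq_src spS; rewrite -(imset_id S).
by apply: (sp_imset (fn := id) spS) => // e eS; rewrite eq_src.
Qed.

Lemma sp_has_src src tgt S s t :
  sp src tgt S s t -> exists2 e, e \in S & src e = s.
Proof.
by elim=> [e|S1 S2 ? ? _ [e eS es] *|S1 S2 ? ? ? _ [e eS es] *]; exists e;
  rewrite ?inE ?eS.
Qed.

Lemma sp_has_tgt src tgt S s t :
  sp src tgt S s t -> exists2 e, e \in S & tgt e = t.
Proof.
by elim=> [e|S1 S2 ? ? _ _ _ [e eS es] *|S1 S2 ? ? ? _ _ _ [e eS es] *];
  exists e; rewrite ?inE ?eS ?orbT.
Qed.

Lemma incident_source src tgt S s t :
  sp src tgt S s t -> incident src tgt S s.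
Proof. by case/sp_has_src=> e eS <-; apply: incident_src. Qed.

Lemma incident_sink src tgt S s t :
  sp src tgt S s t -> incident src tgt S t.
Proof. by case/sp_has_tgt=> e eS <-; apply: incident_tgt. Qed.

(** In a sequential composition with [s = t], this node touches both parts and so equals [c], which
    makes the first part closed. *)
Lemma sp_neq src tgt S s t : sp src tgt S s t -> s <> t.
Proof.
elim=> // [e /eqP //|S1 S2 s' c t' sp1 IH1 sp2 _ _ dN st].
apply: IH1; apply: dN; first exact: incident_source sp1.
by rewrite st; apply: incident_sink sp2.
Qed.

Lemma sp_loopless src tgt S s t e :
  sp src tgt S s t -> e \in S -> src e <> tgt e.
Proof.
by elim=> [e' /eqP ne /set1P -> //|S1 S2 ? ? _ IH1 _ IH2 _ _|
  S1 S2 ? ? ? _ IH1 _ IH2 _ _]; rewrite inE => /orP[].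
Qed.

(** An edge of the second part of a sequential composition entering [s] would make [s] shared, hence
    equal to [c], against [sp_neq]. *)
Lemma sp_source_no_in src tgt S s t e :
  sp src tgt S s t -> e \in S -> tgt e <> s.
Proof.
elim=> {S s t} [e' /eqP ne /set1P -> // /esym//|S1 S2 s t _ IH1 _ IH2 _ _|
  S1 S2 s c t sp1 IH1 sp2 IH2 dE dN]; rewrite inE => /orP[] // eS es; auto.
apply: (sp_neq sp1); apply: dN; first exact: incident_source sp1.
by rewrite -es; apply: incident_tgt.
Qed.

Lemma sp_sink_no_out src tgt S s t e :
  sp src tgt S s t -> e \in S -> src e <> t.
Proof.
elim=> {S s t} [e' /eqP ne /set1P -> //|S1 S2 s t _ IH1 _ IH2 _ _|
  S1 S2 s c t sp1 IH1 sp2 IH2 dE dN]; rewrite inE => /orP[] // eS es; auto.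
apply: (sp_neq sp2); apply/esym/dN; last exact: incident_sink sp2.
by rewrite -es; apply: incident_src.
Qed.

Lemma sp_inv1 src tgt e s t :
  sp src tgt [set e] s t -> src e = s /\ tgt e = t.
Proof.
move=> spe; have [_ /set1P -> ->] := sp_has_src spe.
by have [_ /set1P -> ->] := sp_has_tgt spe.
Qed.

Lemma sp_card_gt0 src tgt S s t : sp src tgt S s t -> 0 < #|S|.
Proof. by case/sp_has_src=> e eS _; apply/card_gt0P; exists e. Qed.

(** * Redexes and their existence *)

Definition parallel_pair src tgt S e1 e2 : Prop :=
  [/\ e1 \in S, e2 \in S, e1 <> e2, src e1 = src e2 & tgt e1 = tgt e2].

(** The last clause is the dangling condition: the middle node, which a path rule deletes, touches
    no further edge. *)
Definition series_pair src tgt S e1 e2 : Prop :=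
  [/\ e1 \in S, e2 \in S, tgt e1 = src e2 &
      forall e, e \in S -> src e = tgt e1 \/ tgt e = tgt e1 ->
        e = e1 \/ e = e2].

(** The final inequality makes the match of a path injective; for a parallel pair, distinct end
    points will come from [sp_loopless]. *)
Definition has_redex src tgt S : Prop :=
  (exists e1 e2, parallel_pair src tgt S e1 e2) \/
  (exists e1 e2, series_pair src tgt S e1 e2 /\ src e1 <> tgt e2).

(* The node of a series redex is not a terminal, hence not shared with the other
   part of a composition. *)
Lemma has_redexU src tgt S1 S2 s t :
  sp src tgt S1 s t ->
  (forall x, incident src tgt S1 x -> incident src tgt S2 x -> x = s \/ x = t) ->
  has_redex src tgt S1 -> has_redex src tgt (S1 :|: S2).
Proof.
move=> sp1 dN [] [e1 [e2]].
  move=> [e1S e2S ne12 s12 t12]; left; exists e1, e2.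
  by split; rewrite ?inE ?e1S ?e2S.
move=> [[e1S e2S e12 eO] ne]; right; exists e1, e2; split=> //.
split; rewrite ?inE ?e1S ?e2S // => e; rewrite inE => /orP[/eO //|eS ex].
have: incident src tgt S2 (tgt e1) by apply/incidentP; exists e.
case/(dN _ (incident_tgt _ _ e1S)) => [/(sp_source_no_in sp1 e1S)//|].
by rewrite e12 => /(sp_sink_no_out sp1 e2S).
Qed.

(** A part with several edges has a redex by induction, and the composition keeps it. Otherwise both
    parts are single edges and themselves form the redex. *)
Lemma sp_has_redex src tgt S s t :
  sp src tgt S s t -> 1 < #|S| -> has_redex src tgt S.
Proof.
elim=> {S s t} [e _|S1 S2 s t sp1 IH1 sp2 IH2 dE dN|
  S1 S2 s c t sp1 IH1 sp2 IH2 dE dN] gt1; first by rewrite cards1 in gt1.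
- have [/IH1|le1] := ltnP 1 #|S1|; first exact: has_redexU sp1 dN.
  have [/IH2|le2] := ltnP 1 #|S2|.
    by rewrite setUC; apply: has_redexU sp2 _ => x /[swap]; apply: dN.
  have /cards1P[e1 e1S] : #|S1| == 1 by rewrite eqn_leq le1 (sp_card_gt0 sp1).
  have /cards1P[e2 e2S] : #|S2| == 1 by rewrite eqn_leq le2 (sp_card_gt0 sp2).
  subst S1 S2; have [s1 t1] := sp_inv1 sp1; have [s2 t2] := sp_inv1 sp2.
  left; exists e1, e2; split; rewrite ?inE ?eqxx ?orbT ?s1 ?s2 ?t1 ?t2 //.
  by move=> e12; apply: (dE e1); rewrite ?e12 set11.
- have [/IH1|le1] := ltnP 1 #|S1|.
    by apply: has_redexU sp1 _ => x /dN h /h ->; right.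
  have [/IH2|le2] := ltnP 1 #|S2|.
    by rewrite setUC; apply: has_redexU sp2 _ => x /[swap] /dN h /h ->; left.
  have /cards1P[e1 e1S] : #|S1| == 1 by rewrite eqn_leq le1 (sp_card_gt0 sp1).
  have /cards1P[e2 e2S] : #|S2| == 1 by rewrite eqn_leq le2 (sp_card_gt0 sp2).
  have sp12 := sp_seq sp1 sp2 dE dN.
  subst S1 S2; have [s1 t1] := sp_inv1 sp1; have [s2 t2] := sp_inv1 sp2.
  right; exists e1, e2; split; last by rewrite s1 t2; apply: sp_neq sp12.
  split; rewrite ?inE ?eqxx ?orbT ?s2 //.
  by move=> e; rewrite !inE => /orP[] /eqP; auto.
Qed.

(** * Contracting and expanding redexes *)

Lemma setU1D S1 S2 (e : E) : e \notin S2 -> (S1 :|: S2) :\ e = S1 :\ e :|: S2.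
Proof.
by move=> eS2; rewrite setDUl; congr (_ :|: _); apply/setDidPl; rewrite disjoint_sym disjoints1.
Qed.

Lemma disjointC (S1 S2 : {set E}) :
  (forall e, e \in S1 -> e \in S2 -> False) ->
  forall e, e \in S2 -> e \in S1 -> False.
Proof. by move=> dE e e2 e1; apply: (dE e). Qed.

Lemma sp_par_remove src tgt S1 S2 s t e :
  sp src tgt S2 s t -> (forall e, e \in S1 -> e \in S2 -> False) ->
  (forall x, incident src tgt S1 x -> incident src tgt S2 x ->
     x = s \/ x = t) ->
  e \in S1 -> S1 = [set e] \/ sp src tgt (S1 :\ e) s t ->
  sp src tgt ((S1 :|: S2) :\ e) s t.
Proof.
move=> sp2 dE dN eS; rewrite setU1D; last by apply/negP; apply: dE.
case=> [->|sp1]; first by rewrite setDv set0U.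
apply: sp_par => // [e'|x]; first by rewrite inE => /andP[_]; apply: dE.
by move/(incidentS (subsetDl _ _)); apply: dN.
Qed.

(** A direct edge cannot lie in a sequential composition, since one of its ends would be shared and
    force [t = c] or [s = c]. So it is peeled off a parallel one. The first alternative is needed
    because the empty edge set is not series-parallel. *)
Lemma sp_remove_direct src tgt S s t e :
  sp src tgt S s t -> e \in S -> src e = s -> tgt e = t ->
  S = [set e] \/ sp src tgt (S :\ e) s t.
Proof.
elim=> {S s t} [e' _ /set1P->|S1 S2 s t sp1 IH1 sp2 IH2 dE dN|
  S1 S2 s c t sp1 IH1 sp2 IH2 dE dN]; first by left.
- rewrite inE => /orP[] eS es et; right.
    by apply: (sp_par_remove sp2 dE dN eS); apply: IH1.
  rewrite setUC; apply: (sp_par_remove sp1 (disjointC dE) _ eS); last exact: IH2.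
  by move=> x /[swap]; apply: dN.
- rewrite inE => /orP[] eS es et.
    case: (sp_neq sp2); apply/esym/dN; last exact: incident_sink sp2.
    by rewrite -et; apply: incident_tgt.
  case: (sp_neq sp1); apply/dN; first exact: incident_source sp1.
  by rewrite -es; apply: incident_src.
Qed.

Lemma sp_contract_parallel src tgt S s t e1 e2 :
  sp src tgt S s t -> parallel_pair src tgt S e1 e2 ->
  sp src tgt (S :\ e2) s t.
Proof.
move=> spS [+ + ne12 s12 t12].
elim: spS => {S s t} [e _ /set1P e1e /set1P e2e|S1 S2 s t sp1 IH1 sp2 IH2 dE dN|
  S1 S2 s c t sp1 IH1 sp2 IH2 dE dN]; first by case: ne12; rewrite e1e.
- have dN' x : incident src tgt S2 x -> incident src tgt S1 x -> x = s \/ x = t.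
    by move=> /[swap]; apply: dN.
  (* For a pair with one edge in each part, both end points are shared, hence terminals. No edge
     leaves [t] or enters [s], so the edges are direct. *)
  have mixed A B : sp src tgt A s t -> sp src tgt B s t ->
      (forall x, incident src tgt A x -> incident src tgt B x ->
         x = s \/ x = t) ->
      e1 \in A -> e2 \in B -> src e2 = s /\ tgt e2 = t.
    move=> spA spB dAB e1A e2B; split.
      have := dAB (src e2); rewrite (incident_src _ _ e2B) -s12.
      rewrite (incident_src _ _ e1A) => -[] //.
      by move/(sp_sink_no_out spA e1A).
    have := dAB (tgt e2); rewrite (incident_tgt _ _ e2B) -t12.
    rewrite (incident_tgt _ _ e1A) => -[] //.
    by move/(sp_source_no_in spA e1A).
  rewrite !inE => /orP[] e1S /orP[] e2S.
  + by apply: (sp_par_remove sp2 dE dN e2S); right; apply: IH1.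
  + have [s2 t2] := mixed _ _ sp1 sp2 dN e1S e2S.
    rewrite setUC; apply: (sp_par_remove sp1 (disjointC dE) dN' e2S).
    exact: sp_remove_direct.
  + have [s2 t2] := mixed _ _ sp2 sp1 dN' e1S e2S.
    by apply: (sp_par_remove sp2 dE dN e2S); apply: sp_remove_direct.
  + rewrite setUC; apply: (sp_par_remove sp1 (disjointC dE) dN' e2S).
    by right; apply: IH2.
(* Here the pair cannot straddle: its common source would be [c], which no edge of the first part
   leaves. *)
- have mixed A B : sp src tgt A s c ->
      (forall x, incident src tgt A x -> incident src tgt B x -> x = c) ->
      forall e e', src e = src e' -> e \in A -> e' \in B -> False.
    move=> spA dAB e e' ee' eA e'B; apply: (sp_sink_no_out spA eA).
    apply: dAB; first exact: incident_src.
    by rewrite ee'; apply: incident_src.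
  have {}mixed := mixed _ _ sp1 dN.
  rewrite !inE => /orP[] e1S /orP[] e2S.
  + rewrite setU1D; last by apply/negP; apply: dE.
    apply: (sp_seq (IH1 e1S e2S) sp2) => [e|x].
      by rewrite inE => /andP[_]; apply: dE.
    by move/(incidentS (subsetDl _ _)); apply: dN.
  + by case: (mixed _ _ s12 e1S e2S).
  + by case: (mixed _ _ (esym s12) e2S e1S).
  + rewrite setUC setU1D; last by apply/negP => /dE; apply.
    rewrite setUC; apply: (sp_seq sp1 (IH2 e1S e2S)) => [e eS|x xS].
      by rewrite inE => /andP[_]; apply: dE.
    by move/(incidentS (subsetDl _ _)); apply: dN.
Qed.

(** The new edge joins the part containing [e1] and touches no new node, so no sharing condition
    changes. At a single edge the result is a parallel composition of two edges. *)
Lemma sp_expand_parallel src tgt S s t e1 e2 :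
  sp src tgt S s t -> e1 \in S -> e2 \notin S ->
  src e1 = src e2 -> tgt e1 = tgt e2 -> sp src tgt (e2 |: S) s t.
Proof.
move=> spS + + s12 t12.
have inc_e2 (A : {set E}) x : e1 \in A ->
    incident src tgt (e2 |: A) x -> incident src tgt A x.
  move=> e1A; rewrite incidentU incident1 -s12 -t12.
  case/orP=> // /orP[] /eqP <-; [exact: incident_src|exact: incident_tgt].
have dE_e2 (A B : {set E}) e : e2 \notin B ->
    (forall e, e \in A -> e \in B -> False) ->
    e \in e2 |: A -> e \in B -> False.
  by move=> e2B dE; rewrite inE => /orP[/set1P -> /(negP e2B)|/dE].
elim: spS => {S s t} [e ne /set1P e1e e2e|S1 S2 s t sp1 IH1 sp2 IH2 dE dN|
  S1 S2 s c t sp1 IH1 sp2 IH2 dE dN].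
- subst e1; apply: sp_par; rewrite ?s12 ?t12; first by apply: sp_one; rewrite -s12 -t12.
  + by rewrite -s12 -t12; apply: sp_one.
  + by move=> e' /set1P -> /(negP e2e).
  + by move=> x; rewrite !incident1 -s12 -t12 => _ /orP[] /eqP; auto.
- rewrite !inE negb_or => /orP[] e1S /andP[n1 n2].
    rewrite setUA; apply: sp_par; [exact: IH1|by []|by move=> e; apply: dE_e2|].
    by move=> x /(inc_e2 _ _ e1S); apply: dN.
  rewrite setUCA; apply: sp_par; [by []|exact: IH2| |].
    by move=> e /[swap]; apply: dE_e2 => //; apply: disjointC.
  by move=> x /dN h /(inc_e2 _ _ e1S).
- rewrite !inE negb_or => /orP[] e1S /andP[n1 n2].
    rewrite setUA; apply: sp_seq; [exact: IH1|exact: sp2|by move=> e; apply: dE_e2|].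
    by move=> x /(inc_e2 _ _ e1S); apply: dN.
  rewrite setUCA; apply: sp_seq; [exact: sp1|exact: IH2| |].
    by move=> e /[swap]; apply: dE_e2 => //; apply: disjointC.
  by move=> x /dN h /(inc_e2 _ _ e1S).
Qed.

Lemma sp_remove_last src tgt S s t e :
  sp src tgt S s t -> e \in S -> tgt e = t ->
  (forall e', e' \in S -> tgt e' = t -> e' = e) ->
  S = [set e] \/ sp src tgt (S :\ e) s (src e).
Proof.
elim=> {S s t} [e' _ /set1P->|S1 S2 s t sp1 IH1 sp2 IH2 dE dN|
  S1 S2 s c t sp1 IH1 sp2 IH2 dE dN]; first by left.
- move=> _ _ uniq_e; have [e1 e1S e1t] := sp_has_tgt sp1.
  have [e2 e2S e2t] := sp_has_tgt sp2; case: (dE e).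
    by rewrite -(uniq_e e1) // inE e1S.
  by rewrite -(uniq_e e2) // inE e2S orbT.
- rewrite inE => /orP[] eS et uniq_e.
    case: (sp_neq sp2); apply/esym/dN; last exact: incident_sink sp2.
    by rewrite -et; apply: incident_tgt.
  right; rewrite setUC setU1D; last by apply/negP => /dE; apply.
  have [|S2e|sp2'] := IH2 eS et.
  + by move=> e' e'S; apply: uniq_e; rewrite inE e'S orbT.
  + by rewrite S2e setDv set0U; rewrite S2e in sp2; have [->] := sp_inv1 sp2.
  + rewrite setUC; apply: sp_seq sp1 sp2' _ _ => [e' e'S|x xS].
      by rewrite inE => /andP[_]; apply: dE.
    by move/(incidentS (subsetDl _ _)); apply: dN.
Qed.

(** Transport along the node map sending [c] to [p] and fixing all else. It is injective on the
    nodes touched because [p] is not among them, and only the source of [e2] changes because no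
    other edge touches [c]. *)
Lemma sp_rename_source src tgt src' S c t e2 p :
  sp src tgt S c t -> e2 \in S -> src e2 = c ->
  (forall e, e \in S -> src e = c -> e = e2) ->
  ~~ incident src tgt S p ->
  src' e2 = p -> (forall e, e != e2 -> src' e = src e) ->
  sp src' tgt S p t.
Proof.
move=> spS e2S e2c uniq_e2 pS src'e2 src'E.
have fnE x : incident src tgt S x -> x = p -> False.
  by move=> xS xp; rewrite -xp xS in pS.
have -> : p = if c == c then p else c by rewrite eqxx.
have -> : t = if t == c then p else t.
  by case: eqP => // tc; case: (sp_neq spS).
rewrite -(imset_id S); apply: (sp_imset (fn := fun x => if x == c then p else x) spS).
- move=> e eS; case: eqP => [/uniq_e2 -> //|ne]; apply: src'E.
  by apply/eqP=> ee2; rewrite ee2 in ne.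
- by move=> e eS; case: eqP => // /(sp_source_no_in spS eS).
- move=> x y xS yS; case: eqP => [->|_]; case: eqP => [->|_] //.
    by move=> /esym /(fnE _ yS).
  by move=> /(fnE _ xS).
- by [].
Qed.

(** The middle node has an edge in and an edge out, so it is not a terminal of a part containing
    both edges. The redex straddles only in a sequential composition at [c]: then [e1] is the last
    edge of the first part and is removed, and the source of the second part moves from [c] to
    [src e1]. *)
Lemma sp_contract_series src tgt src' S s t e1 e2 :
  sp src tgt S s t -> series_pair src tgt S e1 e2 ->
  src' e2 = src e1 -> (forall e, e != e2 -> src' e = src e) ->
  sp src' tgt (S :\ e1) s t.
Proof.
move=> spS [+ + e12 +] src'e2 src'E.
have eq_src (A : {set E}) s' t' : e2 \notin A ->
    sp src tgt A s' t' -> sp src' tgt A s' t'.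
  move=> e2A; apply: eq_sp => e eA; rewrite src'E //.
  by apply: contraNneq e2A => <-.
(* The moved source of [e2] is the source of [e1], so contraction inside [A] touches no new node. *)
have incD (A : {set E}) x : e1 \in A ->
    incident src' tgt (A :\ e1) x -> incident src tgt A x.
  move=> e1A /incidentP[e]; rewrite !inE => /andP[_ eA] [|<-].
    have [->|/src'E ->] := eqVneq e e2; rewrite ?src'e2 => <-; exact: incident_src.
  exact: incident_tgt.
have inc' (A : {set E}) x : e2 \notin A ->
    incident src' tgt A x -> incident src tgt A x.
  move=> e2A /incidentP[e eA]; rewrite src'E; last by apply: contraNneq e2A => <-.
  by move=> ?; apply/incidentP; exists e.
elim: spS => {S s t} [e /eqP ne /set1P e1e /set1P e2e|
  S1 S2 s t sp1 IH1 sp2 IH2 dE dN|S1 S2 s c t sp1 IH1 sp2 IH2 dE dN].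
- by case: ne; rewrite -{1}e2e -e12 e1e.
- rewrite !inE => /orP[] e1S /orP[] e2S eO.
  + have n1 : e1 \notin S2 by apply/negP; apply: dE.
    have n2 : e2 \notin S2 by apply/negP; apply: dE.
    rewrite setU1D //; apply: sp_par.
    * by apply: IH1 => // e eS; apply: eO; rewrite inE eS.
    * exact: eq_src.
    * by move=> e; rewrite inE => /andP[_]; apply: dE.
    * by move=> x /(incD _ _ e1S) xS /(inc' _ _ n2); apply: dN.
  + case: (dN (tgt e1)) => [||/(sp_source_no_in sp1 e1S)//|].
    * exact: incident_tgt.
    * by rewrite e12; apply: incident_src.
    * by rewrite e12 => /(sp_sink_no_out sp2 e2S).
  + case: (dN (tgt e1)) => [||/(sp_source_no_in sp2 e1S)//|].
    * by rewrite e12; apply: incident_src.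
    * exact: incident_tgt.
    * by rewrite e12 => /(sp_sink_no_out sp1 e2S).
  + have n1 : e1 \notin S1 by apply/negP => /dE; apply.
    have n2 : e2 \notin S1 by apply/negP => /dE; apply.
    rewrite setUC setU1D // setUC; apply: sp_par.
    * exact: eq_src.
    * by apply: IH2 => // e eS; apply: eO; rewrite inE eS orbT.
    * by move=> e eS; rewrite inE => /andP[_]; apply: dE.
    * by move=> x /(inc' _ _ n2) xS /(incD _ _ e1S); apply: dN.
- rewrite !inE => /orP[] e1S /orP[] e2S eO.
  + have n1 : e1 \notin S2 by apply/negP; apply: dE.
    have n2 : e2 \notin S2 by apply/negP; apply: dE.
    rewrite setU1D //; apply: sp_seq.
    * by apply: IH1 => // e eS; apply: eO; rewrite inE eS.
    * exact: eq_src sp2.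
    * by move=> e; rewrite inE => /andP[_]; apply: dE.
    * by move=> x /(incD _ _ e1S) xS /(inc' _ _ n2); apply: dN.
  + have n1 : e1 \notin S2 by apply/negP; apply: dE.
    have n2 : e2 \notin S1 by apply/negP => /dE; apply.
    have e1c : tgt e1 = c.
      by apply: dN; [apply: incident_tgt|rewrite e12; apply: incident_src].
    have pS : ~~ incident src tgt S2 (src e1).
      apply/negP => /dN h; apply: (sp_sink_no_out sp1 e1S); apply: h.
      exact: incident_src.
    have sp2' : sp src' tgt S2 (src e1) t.
      apply: (sp_rename_source sp2 e2S _ _ pS) => // [|e eS ec].
        by rewrite -e12.
      case: (eO e) => //; first by rewrite inE eS orbT.
        by left; rewrite ec.
      by move=> ee1; case: (dE e1) => //; rewrite -ee1.
    rewrite setU1D //.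
    have [|S1e|sp1'] := sp_remove_last sp1 e1S e1c.
    * move=> e eS ec; case: (eO e) => //; first by rewrite inE eS.
        by right; rewrite e1c.
      by move=> ee2; rewrite -ee2 eS in n2.
    * by rewrite S1e setDv set0U; rewrite S1e in sp1; have [<-] := sp_inv1 sp1.
    * apply: sp_seq sp2' _ _.
      - by apply: eq_src sp1'; rewrite inE (negPf n2) andbF.
      - by move=> e; rewrite inE => /andP[_]; apply: dE.
      (* The node [c] is impossible: only [e1] and [e2] touch it, and neither is in the rest of the
         first part. *)
      - move=> x xS xS2; suff [//|xc] : x = src e1 \/ x = c.
          have /incidentP[e] := xS; rewrite !inE => /andP[/eqP ne1 eS] ex.
          case: (eO e) => [||//|ee2]; first by rewrite inE eS.
            rewrite e1c -xc; case: ex => <-; auto; left.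
            by rewrite src'E //; apply: contraNneq n2 => <-.
          by rewrite -ee2 eS in n2.
        have /incidentP[e eS ex] := xS2.
        have [ee2|ne] := eqVneq e e2.
          case: ex; rewrite ee2 ?src'e2 => ex; [by left|right].
          by apply: dN; [apply: incD xS|rewrite -ex; apply: incident_tgt].
        by right; apply: dN; [apply: incD xS|apply/incidentP; exists e; rewrite -?src'E].
  + have e1c : tgt e1 = c.
      by apply: dN; [rewrite e12; apply: incident_src|apply: incident_tgt].
    by case: (sp_sink_no_out sp1 e2S); rewrite -e12.
  + have n1 : e1 \notin S1 by apply/negP => /dE; apply.
    have n2 : e2 \notin S1 by apply/negP => /dE; apply.
    rewrite setUC setU1D // setUC; apply: sp_seq.
    * exact: eq_src sp1.
    * by apply: IH2 => // e eS; apply: eO; rewrite inE eS orbT.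
    * by move=> e eS; rewrite inE => /andP[_]; apply: dE.
    * by move=> x /(inc' _ _ n2) xS /(incD _ _ e1S); apply: dN.
Qed.

(** The new edge joins the part containing [e2]. The only node newly touched is the middle one,
    which is fresh and so never shared. At the single edge [e2] the result is a sequential
    composition of [e1] and [e2]. *)
Lemma sp_expand_series src tgt src' S s t e1 e2 :
  sp src' tgt S s t -> e1 \notin S -> e2 \in S -> tgt e1 = src e2 ->
  src' e2 = src e1 -> (forall e, e != e2 -> src' e = src e) ->
  ~~ incident src' tgt S (tgt e1) -> sp src tgt (e1 |: S) s t.
Proof.
move=> spS + + e12 src'e2 src'E.
have eq_src (A : {set E}) s' t' : e2 \notin A ->
    sp src' tgt A s' t' -> sp src tgt A s' t'.
  move=> e2A; apply: eq_sp => e eA; rewrite src'E //.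
  by apply: contraNneq e2A => <-.
have inc' (A : {set E}) x : e2 \notin A ->
    incident src tgt A x -> incident src' tgt A x.
  move=> e2A /incidentP[e eA]; rewrite -src'E; last by apply: contraNneq e2A => <-.
  by move=> ?; apply/incidentP; exists e.
have incU (A : {set E}) x : e2 \in A -> incident src tgt (e1 |: A) x ->
    x = tgt e1 \/ incident src' tgt A x.
  move=> e2A; rewrite incidentU incident1 => /orP[/orP[] /eqP|].
  - by rewrite -src'e2 => <-; right; apply: incident_src.
  - by left.
  - case/incidentP=> e eA; have [->|ne] := eqVneq e e2.
      rewrite -e12 => -[->|<-]; first by left.
      by right; apply: incident_tgt.
    by rewrite -src'E // => ?; right; apply/incidentP; exists e.
have dE1 (A B : {set E}) e : e1 \notin B ->
    (forall e, e \in A -> e \in B -> False) ->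
    e \in e1 |: A -> e \in B -> False.
  by move=> e1B dE; rewrite inE => /orP[/set1P -> /(negP e1B)|/dE].
elim: spS => {S s t} [e ne n1 /set1P e2e fresh|S1 S2 s t sp1 IH1 sp2 IH2 dE dN|
  S1 S2 s c t sp1 IH1 sp2 IH2 dE dN].
- subst e; move: fresh; rewrite incident1 negb_or => /andP[sv tv].
  have ne12 : e1 != e2 by apply: contraNneq n1 => ->; rewrite set11.
  rewrite src'e2; apply: (sp_seq (c := tgt e1)).
  + by apply: sp_one; rewrite -src'e2.
  + by rewrite e12; apply: sp_one; rewrite -e12 eq_sym.
  + by move=> e /set1P -> /set1P /eqP; rewrite (negPf ne12).
  + move=> x; rewrite !incident1 -e12 -src'e2 => /orP[] /eqP <- //.
    by rewrite [tgt e1 == _]eq_sym [tgt e2 == _]eq_sym (negPf sv) (negPf ne).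
- rewrite incidentU !inE !negb_or => /andP[n1 n2] /orP[] e2S /andP[v1 v2].
  + have e2S2 : e2 \notin S2 by apply/negP; apply: dE.
    rewrite setUA; apply: sp_par; [exact: IH1|exact: eq_src| |].
      by move=> e; apply: dE1.
    move=> x /(incU _ _ e2S)[-> /(inc' _ _ e2S2)|xS /(inc' _ _ e2S2)].
      by rewrite (negPf v2).
    exact: dN.
  + have e2S1 : e2 \notin S1 by apply/negP => /dE; apply.
    rewrite setUCA; apply: sp_par; [exact: eq_src|exact: IH2| |].
      by move=> e /[swap]; apply: dE1 => //; apply: disjointC.
    move=> x /(inc' _ _ e2S1) xS /(incU _ _ e2S)[xv|]; last exact: dN.
    by rewrite -xv xS in v1.
- rewrite incidentU !inE !negb_or => /andP[n1 n2] /orP[] e2S /andP[v1 v2].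
  + have e2S2 : e2 \notin S2 by apply/negP; apply: dE.
    rewrite setUA; apply: sp_seq; [exact: IH1|exact: eq_src sp2| |].
      by move=> e; apply: dE1.
    move=> x /(incU _ _ e2S)[-> /(inc' _ _ e2S2)|xS /(inc' _ _ e2S2)].
      by rewrite (negPf v2).
    exact: dN.
  + have e2S1 : e2 \notin S1 by apply/negP => /dE; apply.
    rewrite setUCA; apply: sp_seq; [exact: eq_src sp1|exact: IH2| |].
      by move=> e /[swap]; apply: dE1 => //; apply: disjointC.
    move=> x /(inc' _ _ e2S1) xS /(incU _ _ e2S)[xv|]; last exact: dN.
    by rewrite -xv xS in v1.
Qed.

End SpTheory.

Lemma sp_preimset (E1 E2 N1 : finType) (N2 : eqType)
    (src1 tgt1 : E1 -> N1) (src2 tgt2 : E2 -> N2)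
    (fn : N1 -> N2) (fe : E1 -> E2) (S : {set E2}) s t :
  injective fn -> injective fe ->
  (forall e, src2 (fe e) = fn (src1 e)) ->
  (forall e, tgt2 (fe e) = fn (tgt1 e)) ->
  {subset S <= codom fe} ->
  sp src2 tgt2 S (fn s) (fn t) -> sp src1 tgt1 (fe @^-1: S) s t.
Proof.
move=> fnI feI fsrc ftgt sub spS.
(* A series-parallel edge set is non-empty; this yields the default value [e0] for the partial
   inverse of [fe]. *)
have [_ /sub/codomP[e0 _] _] := sp_has_src spS.
pose gn y := odflt s [pick x | fn x == y].
pose ge y := odflt e0 [pick x | fe x == y].
have gnK : cancel fn gn.
  by move=> x; rewrite /gn; case: pickP => [y /eqP/fnI|/(_ x)/eqP].
have geK : cancel fe ge.
  by move=> x; rewrite /ge; case: pickP => [y /eqP/feI|/(_ x)/eqP].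
have -> : fe @^-1: S = ge @: S.
  apply/setP=> e; rewrite inE; apply/idP/imsetP => [eS|[e' e'S ->]].
    by exists (fe e).
  by have /codomP[e'' e'E] := sub _ e'S; rewrite e'E geK -e'E.
have inc x : incident src2 tgt2 S x -> exists y, x = fn y.
  case/incidentP=> e /sub/codomP[e' ->]; rewrite fsrc ftgt.
  by case=> <-; eexists.
rewrite -(gnK s) -(gnK t); apply: (sp_imset spS).
- by move=> e /sub/codomP[e' ->]; rewrite geK fsrc gnK.
- by move=> e /sub/codomP[e' ->]; rewrite geK ftgt gnK.
- by move=> x y /inc[x' ->] /inc[y' ->]; rewrite !gnK => ->.
- by move=> x y /sub/codomP[x' ->] /sub/codomP[y' ->]; rewrite !geK => ->.
Qed.

(** * Gluings and series-parallel two-terminal graphs *)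

(** Edge sets do not see isolated nodes, so the second conjunct excludes them. *)
Definition sp_spanning (G : digraph) (s t : node G) : Prop :=
  sp (@src G) (@tgt G) setT s t /\
  forall x, incident (@src G) (@tgt G) setT x.

Section GlueEmbedding.
Variables (G H : digraph) (A : pred (node H)) (f : node H -> node G).

Lemma glue_rN y : A y -> @glue_r G H A f y = inl (f y).
Proof. by move=> Ay; rewrite /glue_r insubN // Ay. Qed.

Lemma glue_r_val (u : {y : node H | ~~ A y}) :
  @glue_r G H A f (val u) = inr u.
Proof. by rewrite /glue_r valK. Qed.

Lemma glue_r_inl y x : @glue_r G H A f y = inl x -> A y /\ f y = x.
Proof.
rewrite /glue_r; case: insubP => [//|/negPn Ay] [<-].
by [].
Qed.

Lemma glue_r_inj :
  {in A &, injective f} -> injective (@glue_r G H A f).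
Proof.
move=> fI y y'; have [Ay|/negPf nAy] := boolP (A y).
  by rewrite glue_rN // => /esym/glue_r_inl[Ay' /esym/fI]; apply.
have /idP ny : ~~ A y by rewrite nAy.
rewrite -[y]/(val (exist (fun y => ~~ A y) y ny)) glue_r_val.
have [Ay'|/idP ny'] := boolP (A y'); first by rewrite glue_rN.
rewrite -[y']/(val (exist (fun y => ~~ A y) y' ny')) glue_r_val.
by case.
Qed.

(** The copairing out of the gluing. Identified nodes are represented in [G] only, so compatibility
    of [l] and [r] enters only in [glue_case_r]. *)
Definition glue_case (T : Type) (l : node G -> T) (r : node H -> T)
    (z : glue_node G A) : T :=
  match z with inl x => l x | inr u => r (val u) end.

Lemma glue_case_r (T : Type) (l : node G -> T) (r : node H -> T) y :
  (forall y, A y -> r y = l (f y)) ->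
  glue_case l r (@glue_r G H A f y) = r y.
Proof.
by move=> rl; rewrite /glue_r; case: insubP => [u _ <-//|/negPn /rl ->].
Qed.

End GlueEmbedding.

Section GlueSp.
Variables (G H : digraph) (A : pred (node H)) (f : node H -> node G).
Let K := @glue G H A f.

Lemma glue_setT : [set: edge K] = inl @: [set: edge G] :|: inr @: [set: edge H].
Proof.
apply/setP=> -[] e; rewrite in_setT in_setU; apply/esym/orP.
  by left; apply/imsetP; exists e.
by right; apply/imsetP; exists e.
Qed.

Lemma glue_edges_disjoint (e : edge K) :
  e \in inl @: [set: edge G] -> e \in inr @: [set: edge H] -> False.
Proof. by move=> /imsetP[e1 _ ->] /imsetP[]. Qed.

Lemma glue_shared (x : node K) :
  incident (@src K) (@tgt K) (inl @: [set: edge G]) x ->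
  incident (@src K) (@tgt K) (inr @: [set: edge H]) x ->
  exists2 y, A y & x = glue_r A f y.
Proof.
move=> /(@incident_imset _ _ _ _ (@src G) (@tgt G) _ _ (glue_l A))[//|//|x1 _ ->].
move=> /(@incident_imset _ _ _ _ (@src H) (@tgt H) _ _ (glue_r A f))[//|//|y _].
by move=> xy; exists y => //; have [] := glue_r_inl (esym xy).
Qed.

Lemma glue_spanned :
  (forall x, incident (@src G) (@tgt G) setT x) ->
  (forall x, incident (@src H) (@tgt H) setT x) ->
  forall x, incident (@src K) (@tgt K) setT x.
Proof.
move=> incG incH [x|u]; last rewrite -(glue_r_val f).
  case/incidentP: (incG x) => e _ ex; apply/incidentP; exists (inl e) => /=; first by rewrite in_setT.
  by case: ex => <-; auto.
case/incidentP: (incH (val u)) => e _ ex; apply/incidentP; exists (inr e) => /=; first by rewrite in_setT.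
by case: ex => <-; auto.
Qed.

Lemma sp_glue_l s t : sp (@src G) (@tgt G) setT s t ->
  sp (@src K) (@tgt K) (inl @: [set: edge G]) (glue_l A s) (glue_l A t).
Proof.
by move=> spG; apply: (sp_imset (fn := glue_l A) spG) => // x y _ _ [].
Qed.

Lemma sp_glue_r s t : {in A &, injective f} ->
  sp (@src H) (@tgt H) setT s t ->
  sp (@src K) (@tgt K) (inr @: [set: edge H]) (glue_r A f s) (glue_r A f t).
Proof.
move=> fI spH; apply: (sp_imset (fn := glue_r A f) spH) => // x y _ _; last by case.
exact: glue_r_inj.
Qed.

End GlueSp.

Lemma series_parallel_sp (X : two_terminal) :
  series_parallel X -> sp_spanning (source X) (sink X).
Proof.
elim=> {X} [|X Y _ [spX incX] _ [spY incY]|X Y _ [spX incX] _ [spY incY]|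
  X Y [f [[fnB feB] fs ft]] _ [spX incX]].
- split.
    have -> : [set: edge edge_digraph] = [set tt] by apply/setP=> -[]; rewrite !inE.
    exact: (@sp_one _ _ (@src edge_digraph) (@tgt edge_digraph) tt).
  by move=> x; apply/incidentP; exists tt => //=; case: x; auto.
- have /eqP/negPf neX := sp_neq spX; have /eqP/negPf neY := sp_neq spY.
  split; last exact: glue_spanned.
  rewrite glue_setT; apply: sp_par.
  + exact: sp_glue_l.
  + pose f y := if y == source Y then source X else sink X.
    pose A := pred2 (source Y) (sink Y).
    have fs : f (source Y) = source X by rewrite /f eqxx.
    have ft : f (sink Y) = sink X by rewrite /f eq_sym neY.
    (* Since the terminals of [X] are distinct, [Y] is embedded in the gluing without collapsing its
       own terminals. *)
    have fI : {in A &, injective f}.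
      move=> y y' /orP[] /eqP -> /orP[] /eqP -> //; rewrite fs ft => /eqP;
        by rewrite ?[sink X == _]eq_sym neX.
    have := sp_glue_r fI spY; rewrite !glue_rN ?fs ?ft //.
      by rewrite /A /= eqxx orbT.
    by rewrite /A /= eqxx.
  + exact: glue_edges_disjoint.
  + move=> x /glue_shared h /h[y Ay ->]; rewrite glue_rN //.
    by case: (y == source Y); [left|right].
- split; last exact: glue_spanned.
  rewrite glue_setT; apply: sp_seq.
  + exact: sp_glue_l spX.
  + pose A := pred1 (source Y); pose f (_ : node Y) := sink X.
    have fI : {in A &, injective f} by move=> y y' /eqP -> /eqP ->.
    have := sp_glue_r fI spY; rewrite (@glue_rN _ _ A f (source Y)) //.
    by rewrite /A /= eqxx.
  + exact: glue_edges_disjoint.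
  + by move=> x /glue_shared h /h[y Ay ->]; rewrite glue_rN.
- have [[gn fnK gnK] [ge feK geK]] := (fnB, feB); split.
    have -> : [set: edge Y] = fedge f @: setT.
      by apply/setP=> e; rewrite inE -[e]geK imset_f.
    rewrite -fs -ft; apply: (sp_imset spX).
    * by move=> e _; apply: src_morph.
    * by move=> e _; apply: tgt_morph.
    * by move=> x y _ _; apply: (can_inj fnK).
    * by move=> x y _ _; apply: (can_inj feK).
  move=> x; case/incidentP: (incX (gn x)) => e _ ex.
  apply/incidentP; exists (fedge f e) => //.
  by rewrite src_morph tgt_morph; case: ex => ->; rewrite gnK; auto.
Qed.

(* X is a copy of the subgraph spanned by the edge set S of the ambient graph. *)
Definition represents (E : finType) (N : eqType) (src' tgt' : E -> N)
    (S : {set E}) (s t : N) (X : two_terminal) : Prop :=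
  exists (fn : node X -> N) (fe : edge X -> E),
    [/\ injective fn, injective fe,
        (forall e, src' (fe e) = fn (src e)) /\
        (forall e, tgt' (fe e) = fn (tgt e)),
        (forall e, e \in S <-> exists d, fe d = e) /\
        (forall x, incident src' tgt' S x <-> exists y, fn y = x) &
        fn (source X) = s /\ fn (sink X) = t].

(** Both copies embed with the same images in the ambient graph, so preimages can be matched by
    finite choice. *)
Lemma represents_iso (E : finType) (N : eqType) (src' tgt' : E -> N) S s t X Y :
  represents src' tgt' S s t X -> represents src' tgt' S s t Y ->
  two_terminal_iso X Y.
Proof.
move=> [xn [xe [xnI xeI [xsrc xtgt] [xE xN] [xs xt]]]].
move=> [yn [ye [ynI yeI [ysrc ytgt] [yE yN] [ys yt]]]].
have /fin_all_exists[fn fnE] x : exists y, yn y = xn x.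
  by apply/yN/xN; exists x.
have /fin_all_exists[gn gnE] x : exists y, xn y = yn x.
  by apply/xN/yN; exists x.
have /fin_all_exists[fe feE] x : exists y, ye y = xe x.
  by apply/yE/xE; exists x.
have /fin_all_exists[ge geE] x : exists y, xe y = ye x.
  by apply/xE/yE; exists x.
have fsrc e : src (fe e) = fn (src e) by apply: ynI; rewrite -ysrc feE xsrc fnE.
have ftgt e : tgt (fe e) = fn (tgt e) by apply: ynI; rewrite -ytgt feE xtgt fnE.
exists (DMorphism fsrc ftgt); split=> /=.
- split; [exists gn|exists ge] => x.
  + by apply: xnI; rewrite gnE fnE.
  + by apply: ynI; rewrite fnE gnE.
  + by apply: xeI; rewrite geE feE.
  + by apply: yeI; rewrite feE geE.
- by apply: ynI; rewrite fnE xs ys.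
- by apply: ynI; rewrite fnE xt yt.
Qed.

(* Common to both compositions: the nodes shared by S1 and S2 are exactly those
   identified in the gluing. *)
Lemma represents_glue (E : finType) (N : eqType) (src' tgt' : E -> N) (S1 S2 : {set E})
    (G H : digraph) (A : pred (node H)) (f : node H -> node G)
    (xn : node G -> N) (xe : edge G -> E) (yn : node H -> N) (ye : edge H -> E)
    (s t : node (glue A f)) :
  injective xn -> injective xe ->
  (forall e, src' (xe e) = xn (src e)) -> (forall e, tgt' (xe e) = xn (tgt e)) ->
  (forall e, e \in S1 <-> exists d, xe d = e) ->
  (forall x, incident src' tgt' S1 x <-> exists y, xn y = x) ->
  injective yn -> injective ye ->
  (forall e, src' (ye e) = yn (src e)) -> (forall e, tgt' (ye e) = yn (tgt e)) ->
  (forall e, e \in S2 <-> exists d, ye d = e) ->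
  (forall x, incident src' tgt' S2 x <-> exists y, yn y = x) ->
  (forall e, e \in S1 -> e \in S2 -> False) ->
  (forall y, A y -> yn y = xn (f y)) ->
  (forall x y, xn x = yn y -> A y) ->
  represents src' tgt' (S1 :|: S2) (glue_case xn yn s) (glue_case xn yn t)
    (TwoTerminal s t).
Proof.
move=> xnI xeI xsrc xtgt xE xN ynI yeI ysrc ytgt yE yN dE rl sh.
have sh' x (u : {y : node H | ~~ A y}) : xn x = yn (val u) -> False.
  by move/sh; apply/negP; apply: valP u.
have dE' e e' : xe e = ye e' -> False.
  by move=> ee'; apply: (dE (xe e)); [apply/xE|apply/yE; rewrite ee']; eexists.
exists (glue_case xn yn),
  (fun e : edge (glue A f) => match e with inl d => xe d | inr d => ye d end).
split=> //.
- move=> [x|u] [y|v] /=.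
  + by move=> /xnI ->.
  + by move=> /sh'.
  + by move=> /esym /sh'.
  + by move=> /ynI/val_inj ->.
- move=> [x|x] [y|y].
  + by move=> /xeI ->.
  + by move=> /dE'.
  + by move=> /esym /dE'.
  + by move=> /yeI ->.
- by split=> -[e|e] //=; rewrite glue_case_r.
- split=> [e|x].
    rewrite inE; split=> [/orP[/xE|/yE] [d dE0]|[[d|d] <-]].
    * by exists (inl d).
    * by exists (inr d).
    * by apply/orP; left; apply/xE; exists d.
    * by apply/orP; right; apply/yE; exists d.
  rewrite incidentU; split=> [/orP[/xN|/yN] [y yE0]|[[y|u] <-]].
  * by exists (inl y).
  * by exists (glue_r A f y); rewrite glue_case_r.
  * by apply/orP; left; apply/xN; exists y.
  * by apply/orP; right; apply/yN; exists (val u).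
Qed.

(** The parts of a presentation are not whole graphs, so the induction builds a separate
    two-terminal graph for each of them. *)
Lemma sp_represented (E : finType) (N : eqType) (src' tgt' : E -> N) S s t :
  sp src' tgt' S s t ->
  exists X, series_parallel X /\ represents src' tgt' S s t X.
Proof.
elim=> {S s t} [e ne|S1 S2 s t sp1 [X [spX repX]] sp2 [Y [spY repY]] dE dN|
  S1 S2 s c t sp1 [X [spX repX]] sp2 [Y [spY repY]] dE dN].
- exists (@TwoTerminal edge_digraph false true); split; first exact: sp_edge.
  exists (fun b : bool => if b then tgt' e else src' e), (fun=> e); split=> //.
  + by case=> [] [] // /eqP; rewrite ?[tgt' e == _]eq_sym (negPf ne).
  + by case=> [] [].
  + split=> [e'|x]; first by rewrite inE; split=> [/eqP ->|[_ ->]//]; exists tt.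
    rewrite incident1; split=> [/orP[] /eqP <-|[[] <-]].
    * by exists false.
    * by exists true.
    * by rewrite eqxx orbT.
    * by rewrite eqxx.
- move: repX repY => [xn [xe [xnI xeI [xsrc xtgt] [xE xN] [xs xt]]]].
  move=> [yn [ye [ynI yeI [ysrc ytgt] [yE yN] [ys yt]]]].
  exists (parallel X Y); split; first exact: sp_parallel.
  have nst : (sink Y == source Y) = false.
    by apply/eqP=> st; apply: (sp_neq sp1); rewrite -ys -yt st.
  have := @represents_glue _ _ src' tgt' S1 S2 X Y
    (pred2 (source Y) (sink Y)) (fun y => if y == source Y then source X else sink X)
    xn xe yn ye (inl (source X)) (inl (sink X)).
  rewrite /= xs xt; apply=> //.
  + by move=> y /orP[] /eqP ->; rewrite ?eqxx ?nst ?xs ?xt.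
  + move=> x y xy; apply/orP; case: (dN (yn y)).
    * by apply/xN; exists x.
    * by apply/yN; exists y.
    * by rewrite -ys => /ynI ->; left.
    * by rewrite -yt => /ynI ->; right.
- move: repX repY => [xn [xe [xnI xeI [xsrc xtgt] [xE xN] [xs xt]]]].
  move=> [yn [ye [ynI yeI [ysrc ytgt] [yE yN] [ys yt]]]].
  exists (sequential X Y); split; first exact: sp_sequential.
  pose A : pred (node Y) := pred1 (source Y).
  pose f (_ : node Y) := sink X.
  have rl y : A y -> yn y = xn (f y) by move=> /eqP ->; rewrite ys xt.
  have := @represents_glue _ _ src' tgt' S1 S2 X Y A f
    xn xe yn ye (inl (source X)) (glue_r A f (sink Y)).
  rewrite (glue_case_r _ rl) /= xs yt; apply=> //.
  move=> x y xy; apply/eqP/ynI; rewrite ys; apply: dN.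
    by apply/xN; exists x.
  by apply/yN; exists y.
Qed.

(** For the converse, [G] itself and the graph built from its presentation both represent the full
    edge set, hence are isomorphic. *)
Lemma series_parallelP (G : digraph) (s t : node G) :
  series_parallel (TwoTerminal s t) <-> sp_spanning s t.
Proof.
split=> [/series_parallel_sp //|[spG incG]].
have [X [spX repX]] := sp_represented spG; apply: (sp_iso _ spX).
apply: (represents_iso repX); exists id, id; split=> //; split=> x.
  by rewrite inE; split=> // _; exists x.
by rewrite incG; split=> // _; exists x.
Qed.

(** * Isomorphisms and pushouts *)

Section MorphismComposition.
Variable Sg : alphabet.

Program Definition morph_comp (F G H : graph Sg) (g : morphism G H)
    (f : morphism F G) : morphism F H :=
  @Morphism Sg F H (dmorph_comp g f) _ _.
Next Obligation. by rewrite !nlab_morph. Qed.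
Next Obligation. by rewrite !elab_morph. Qed.

Program Definition morph_id (G : graph Sg) : morphism G G :=
  @Morphism Sg G G (@DMorphism G G id id _ _) _ _.

Lemma morph_inverse (G H : graph Sg) (f : morphism G H) : dmorph_bij f ->
  exists g : morphism H G,
    [/\ cancel (fnode f) (fnode g), cancel (fnode g) (fnode f),
        cancel (fedge f) (fedge g) & cancel (fedge g) (fedge f)].
Proof.
case=> [[gn fnK gnK] [ge feK geK]].
have gsrc e : src (ge e) = gn (src e).
  by apply: (can_inj fnK); rewrite -src_morph geK gnK.
have gtgt e : tgt (ge e) = gn (tgt e).
  by apply: (can_inj fnK); rewrite -tgt_morph geK gnK.
have gnl x : nlab (gn x) = nlab x by rewrite -(nlab_morph f) gnK.
have gel e : elab (ge e) = elab e by rewrite -(elab_morph f) geK.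
by exists (@Morphism Sg H G (DMorphism gsrc gtgt) gnl gel).
Qed.

Lemma isomorphic_sym (G H : graph Sg) : isomorphic G H -> isomorphic H G.
Proof.
case=> f /morph_inverse[g [fnK gnK feK geK]]; exists g.
by split; [exists (fnode f)|exists (fedge f)].
Qed.

Lemma pushout_iso (A B C D D' : graph Sg) (f : morphism A B)
    (g : morphism A C) (h : morphism B D) (k : morphism C D)
    (w : morphism D D') :
  dmorph_bij w -> pushout f g h k ->
  pushout f g (morph_comp w h) (morph_comp w k).
Proof.
move=> /morph_inverse[v [wnK vnK weK veK]] [[commn comme] univ].
split.
  by split=> x; [apply: (congr1 (fnode w) (commn x))|apply: (congr1 (fedge w) (comme x))].
move=> X h' k' /univ[u [[uhn uhe] [ukn uke] u_uniq]].
exists (morph_comp u v); split.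
- by split=> x /=; rewrite ?wnK ?weK; [apply: uhn|apply: uhe].
- by split=> x /=; rewrite ?wnK ?weK; [apply: ukn|apply: uke].
move=> u' u'h u'k; have [||un ue] := u_uniq (morph_comp u' w); [done|done|].
by split=> x /=; [rewrite -un|rewrite -ue]; rewrite /= ?vnK ?veK.
Qed.

(** Pushout objects are determined only up to isomorphism, so an isomorphism after a step is
    absorbed into the step. *)
Lemma step_iso (T : system Sg) (G H H' : graph Sg) :
  step T G H -> isomorphic H H' -> step T G H'.
Proof.
move=> [r [rT [m [D [d [c [m' [c' [mI po1 po2]]]]]]]]] [w wB].
exists r; split=> //; exists m, D, d, c, (morph_comp w m'), (morph_comp w c').
by split=> //; apply: pushout_iso.
Qed.

End MorphismComposition.

Section Pushouts.
Variables (B C D : graph Sigma) (f : morphism two_nodes B)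
  (g : morphism two_nodes C) (h : morphism B D) (k : morphism C D).

(* Pushouts of injections from the discrete graph on two nodes, described by
   elements instead of the universal property. *)
Record po_square : Prop := PoSquare {
  po_comm : forall a, fnode h (fnode f a) = fnode k (fnode g a);
  po_injn1 : injective (fnode h);
  po_inje1 : injective (fedge h);
  po_injn2 : injective (fnode k);
  po_inje2 : injective (fedge k);
  po_meet : forall b c, fnode h b = fnode k c ->
    exists2 a, b = fnode f a & c = fnode g a;
  po_disj : forall b c, fedge h b = fedge k c -> False;
  po_covern : forall x, (exists b, x = fnode h b) \/ (exists c, x = fnode k c);
  po_covere : forall e, (exists b, e = fedge h b) \/ (exists c, e = fedge k c) }.

Lemma po_square_pushout : po_square -> pushout f g h k.
Proof.
case=> comm hn he kn ke meet disj covn cove.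
split=> [|X h' k' [h'k' _]]; first by split=> // -[].
(* The mediating map is chosen pointwise. Values prescribed from both sides agree, since the overlap
   is the image of the two interface nodes. *)
have /fin_all_exists[un unE] x : exists y,
    (forall b, x = fnode h b -> y = fnode h' b) /\
    (forall c, x = fnode k c -> y = fnode k' c).
  case: (covn x) => [[b ->]|[c ->]].
    exists (fnode h' b); split=> [b' /hn <- //|c /meet[a -> ->]].
    exact: h'k'.
  exists (fnode k' c); split=> [b /esym/meet[a -> ->]|c' /kn <- //].
  by apply/esym/h'k'.
have /fin_all_exists[ue ueE] x : exists y,
    (forall b, x = fedge h b -> y = fedge h' b) /\
    (forall c, x = fedge k c -> y = fedge k' c).
  case: (cove x) => [[b ->]|[c ->]].
    by exists (fedge h' b); split=> [b' /he <- //|c /disj].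
  by exists (fedge k' c); split=> [b /esym/disj|c' /ke <- //].
have unh b : un (fnode h b) = fnode h' b by apply: (unE _).1.
have unk c : un (fnode k c) = fnode k' c by apply: (unE _).2.
have ueh b : ue (fedge h b) = fedge h' b by apply: (ueE _).1.
have uek c : ue (fedge k c) = fedge k' c by apply: (ueE _).2.
have usrc e : src (ue e) = un (src e).
  by case: (cove e) => -[e' ->]; rewrite ?ueh ?uek !src_morph ?unh ?unk.
have utgt e : tgt (ue e) = un (tgt e).
  by case: (cove e) => -[e' ->]; rewrite ?ueh ?uek !tgt_morph ?unh ?unk.
have uel e : elab (ue e) = elab e.
  by case: (cove e) => -[e' ->]; rewrite ?ueh ?uek !elab_morph.
have unl x : nlab (un x) = nlab x by case: (nlab _); case: (nlab _).
exists (@Morphism Sigma D X (DMorphism usrc utgt) unl uel); split=> //.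
move=> u' [u'hn u'he] [u'kn u'ke]; split=> x /=.
  case: (covn x) => -[y ->]; rewrite ?unh ?unk; [exact: u'hn|exact: u'kn].
case: (cove x) => -[y ->]; rewrite ?ueh ?uek; [exact: u'he|exact: u'ke].
Qed.

(* The concrete pushout object is a gluing of C and B along the image of f.  The
   universal property maps D to it, which transfers injectivity and disjointness
   to h and k; the composite D -> gluing -> D is the identity, so h and k cover
   D. *)
Lemma pushout_po_square :
  injective (fnode f) -> injective (fnode g) -> pushout f g h k -> po_square.
Proof.
move=> fI gI [[comm _] univ].
pose A : pred (node B) := fun b => b \in codom (fnode f).
(* As [f] is injective, the test [fnode f true == b] recovers the interface node mapped to [b]. *)
pose r b := fnode g (fnode f true == b).
have rf a : r (fnode f a) = fnode g a by rewrite /r (inj_eq fI); case: a.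
have A_f a : A (fnode f a) by apply: codom_f.
pose P := @ab_graph (@glue C B A r)
  (fun e => match e with inl d => elab d | inr d => elab d end).
have hsrc e : @src P (inr e) = glue_r A r (src e) by [].
have htgt e : @tgt P (inr e) = glue_r A r (tgt e) by [].
have ksrc e : @src P (inl e) = glue_l A (src e) by [].
have ktgt e : @tgt P (inl e) = glue_l A (tgt e) by [].
have unitP (G : graph Sigma) (x : node G) (y : node P) : nlab y = nlab x.
  by case: (nlab x).
pose h' := @Morphism Sigma B P (DMorphism hsrc htgt)
  (fun x => unitP _ x _) (fun=> erefl).
pose k' := @Morphism Sigma C P (DMorphism ksrc ktgt)
  (fun x => unitP _ x _) (fun=> erefl).
have [|u [[uhn uhe] [ukn uke] _]] := univ P h' k'.
  by split=> [a|[]] /=; rewrite glue_rN // rf.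
have uhn' b : fnode u (fnode h b) = glue_r A r b := uhn b.
have ukn' c : fnode u (fnode k c) = inl c := ukn c.
have uhe' b : fedge u (fedge h b) = inr b := uhe b.
have uke' c : fedge u (fedge k c) = inl c := uke c.
have rfk b : A b -> fnode h b = fnode k (r b).
  by move=> /codomP[a ->]; rewrite rf; apply: comm.
pose wn : node P -> node D := glue_case (fnode k) (fnode h).
pose we (e : edge P) : edge D :=
  match e with inl d => fedge k d | inr d => fedge h d end.
have wnr b : wn (glue_r A r b) = fnode h b by apply: glue_case_r.
have wsrc e : src (we e) = wn (src e).
  by case: e => e; rewrite /we src_morph //; rewrite -wnr.
have wtgt e : tgt (we e) = wn (tgt e).
  by case: e => e; rewrite /we tgt_morph //; rewrite -wnr.
have wel e : elab (we e) = elab e by case: e => e; rewrite /we elab_morph.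
have wnl x : nlab (wn x) = nlab x by case: (nlab _); case: (nlab _).
pose w := @Morphism Sigma P D (DMorphism wsrc wtgt) wnl wel.
(* Uniqueness for the cocone [h], [k] itself: the identity of [D] and [w] after [u] both mediate, so
   they agree. *)
have [|v [_ _ v_uniq]] := univ D h k; first by split=> // -[].
have [idn ide] : dmorph_eq (morph_id D) v by apply: v_uniq.
have [wun wue] : dmorph_eq (morph_comp w u) v.
  apply: v_uniq; split=> x /=.
  - by rewrite uhn'.
  - by rewrite uhe'.
  - by rewrite ukn'.
  - by rewrite uke'.
have wunK x : wn (fnode u x) = x by rewrite -[RHS]/(fnode (morph_id D) x) idn -wun.
have wueK x : we (fedge u x) = x by rewrite -[RHS]/(fedge (morph_id D) x) ide -wue.
split.
- exact: comm.
- move=> b b' /(congr1 (fnode u)); rewrite !uhn'; apply: glue_r_inj.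
  move=> x y /codomP[a ->] /codomP[a' ->].
  by rewrite !rf => /gI ->.
- by move=> b b' /(congr1 (fedge u)); rewrite !uhe' => -[].
- by move=> c c' /(congr1 (fnode u)); rewrite !ukn' => -[].
- by move=> c c' /(congr1 (fedge u)); rewrite !uke' => -[].
- move=> b c /(congr1 (fnode u)); rewrite uhn' ukn' => /glue_r_inl[/codomP[a ->]].
  by rewrite rf => <-; exists a.
- by move=> b c /(congr1 (fedge u)); rewrite uhe' uke'.
- move=> x; rewrite -[x]wunK; case: (fnode u x) => [c|b].
    by right; exists c.
  by left; exists (val b).
- move=> x; rewrite -[x]wueK; case: (fedge u x) => [c|b].
    by right; exists c.
  by left; exists b.
Qed.

End Pushouts.

(** * Derivations as contractions *)

(* Both kinds of left-hand sides have exactly two edges, the second of which ends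
   in node 2.  A derivation with such a left-hand side amounts to deleting the
   image of the first edge and moving the source of the image of the second one
   to the image of node 1, so H is a subgraph of G with a modified src. *)
Section Derivations.
Variables (L : graph Sigma) (i : morphism two_nodes L) (e1 e2 : edge L).
Hypotheses (i_inj : injective (fnode i)) (e12 : e1 != e2)
  (e12P : forall e, e = e1 \/ e = e2) (e2_tgt : tgt e2 = fnode i true).
Let j : morphism two_nodes (P_ lab_a) := @two_nodes_morphism (P_ lab_a) id.
Variable G : graph Sigma.

Definition move_src (d : edge G) (p : node G) (e : edge G) : node G :=
  if e == d then p else src e.

(** The maps [fn] and [fe] embed [H] in [G], with the moved source. [ctr_nodes] deletes the matched
    nodes outside the interface, [ctr_dangling] records the dangling condition of the match, and
    [ctr_lab] remembers the edge created by the rule. *)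
Record contraction (m : morphism L G) (H : graph Sigma)
    (fn : node H -> node G) (fe : edge H -> edge G) : Prop := Contraction {
  ctr_injn : injective fn;
  ctr_inje : injective fe;
  ctr_src : forall e, move_src (fedge m e2) (fnode m (fnode i false)) (fe e)
                      = fn (src e);
  ctr_tgt : forall e, tgt (fe e) = fn (tgt e);
  ctr_edges : forall e, e != fedge m e1 <-> exists d, fe d = e;
  ctr_nodes : forall x, (forall z, fnode m z = x -> z \in codom (fnode i)) <->
                        exists y, fn y = x;
  ctr_dangling : forall z e, z \notin codom (fnode i) ->
    src e = fnode m z \/ tgt e = fnode m z ->
    e = fedge m e1 \/ e = fedge m e2;
  ctr_lab : exists e : edge H, elab e = lab_a }.

(** The context [D] embeds in both [G] and [H]. Both nodes of the right-hand side are interface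
    nodes, so [D] misses only the created edge of [H], which is sent to the image of [e2]. *)
Lemma derivation_contraction (D H : graph Sigma) (m : morphism L G)
    (d : morphism two_nodes D) (c : morphism D G) (m' : morphism (P_ lab_a) H)
    (c' : morphism D H) :
  dmorph_inj m -> pushout i d m c -> pushout j d m' c' ->
  exists (fn : node H -> node G) (fe : edge H -> edge G), contraction m fn fe.
Proof.
move=> [mn _] po1 po2.
have dI : injective (fnode d).
  have [[comm _] _] := po1 => x y xy; apply/i_inj/mn.
  by have /= -> := comm x; have /= -> := comm y; rewrite xy.
have jI : injective (fnode j) by [].
have [comm1 _ m_e cn ce meet1 disj1 covn1 cove1] := pushout_po_square i_inj dI po1.
have [comm2 _ _ cn' ce' _ disj2 covn2 cove2] := pushout_po_square jI dI po2.
have /fin_all_exists[fn fnE] x : exists y, exists2 z, x = fnode c' z & y = fnode c z.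
  case: (covn2 x) => [[b ->]|[z ->]]; last by exists (fnode c z), z.
  by exists (fnode c (fnode d b)), (fnode d b) => //; rewrite -comm2.
have /fin_all_exists[fe feE] e : exists e',
    (e = fedge m' tt /\ e' = fedge m e2) \/
    (exists2 z, e = fedge c' z & e' = fedge c z).
  case: (cove2 e) => [[[] ->]|[z ->]]; first by exists (fedge m e2); left.
  by exists (fedge c z); right; exists z.
have fnc z : fn (fnode c' z) = fnode c z.
  by have [z' /cn' <-] := fnE (fnode c' z).
have fec z : fe (fedge c' z) = fedge c z.
  by have [[/esym/disj2]|[z' /ce' <-]] := feE (fedge c' z).
have fem : fe (fedge m' tt) = fedge m e2.
  by have [[_ ->]|[z /disj2]] := feE (fedge m' tt).
have fnm b : fn (fnode m' b) = fnode m (fnode i b).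
  by rewrite [fnode m' b]comm2 fnc -comm1.
exists fn, fe; split.
- move=> x y; have [z -> ->] := fnE x; have [z' -> ->] := fnE y.
  by move=> /cn ->.
- move=> x y; have [[-> ->]|[z -> ->]] := feE x; have [[-> ->]|[z' -> ->]] := feE y.
  + by [].
  + by move=> /disj1.
  + by move=> /esym/disj1.
  + by move=> /ce ->.
- move=> e; case: (cove2 e) => [[[] ->]|[z ->]]; rewrite /move_src.
    by rewrite fem eqxx src_morph fnm.
  rewrite fec ifN ?src_morph ?fnc //.
  by apply/eqP=> /esym/disj1.
- move=> e; case: (cove2 e) => [[[] ->]|[z ->]].
    by rewrite fem !tgt_morph fnm e2_tgt.
  by rewrite fec !tgt_morph fnc.
- move=> e; split=> [/eqP ne|[d' <-]].
    case: (cove1 e) => [[b]|[z ->]]; last by exists (fedge c' z).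
    case: (e12P b) => -> eE //; exists (fedge m' tt).
    by rewrite fem.
  have [[_ ->]|[z _ ->]] := feE d'; last by apply/eqP=> /esym/disj1.
  by rewrite (inj_eq m_e) eq_sym.
- move=> x; split=> [keep|[y <-] z].
    case: (covn1 x) => [[b xb]|[z ->]]; last by exists (fnode c' z).
    have /codomP[a ba] := keep b (esym xb); exists (fnode m' a).
    by rewrite fnm xb ba.
  have [y' _ ->] := fnE y; move=> /meet1[a -> _]; exact: codom_f.
- move=> z e zi; case: (cove1 e) => [[b ->]|[e' ->]].
    by case: (e12P b) => ->; auto.
  by rewrite src_morph tgt_morph => -[] /esym/meet1[a za _];
    rewrite za codom_f in zi.
- by exists (fedge m' tt); rewrite elab_morph.
Qed.

Lemma contraction_exists (m : morphism L G) :
  dmorph_inj m ->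
  (forall z e, z \notin codom (fnode i) ->
    src e = fnode m z \/ tgt e = fnode m z ->
    e = fedge m e1 \/ e = fedge m e2) ->
  exists (H D : graph Sigma) (d : morphism two_nodes D) (c : morphism D G)
      (m' : morphism (P_ lab_a) H) (c' : morphism D H),
    pushout i d m c /\ pushout j d m' c'.
Proof.
move=> [mn m_e] dang.
pose keepn x := [forall z, (fnode m z == x) ==> (z \in codom (fnode i))].
pose keepe e := (e != fedge m e1) && (e != fedge m e2).
(* The dangling condition makes the kept nodes and edges a graph; this is the context [D]. The
   result [H] adds [None] as the created edge. *)
have keepP e x : keepe e -> src e = x \/ tgt e = x -> keepn x.
  move=> /andP[/eqP ne1 /eqP ne2] ex; apply/forallP=> z; apply/implyP=> /eqP mz.
  by apply: contraPT isT => zi; case: (dang z e zi); rewrite ?mz.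
have keepi b : keepn (fnode m (fnode i b)).
  by apply/forallP=> z; apply/implyP=> /eqP/mn ->; apply: codom_f.
pose DN : finType := {x : node G | keepn x}.
pose DE : finType := {e : edge G | keepe e}.
pose dsrc (e : DE) : DN := Sub (src (val e)) (keepP _ _ (valP e) (or_introl erefl)).
pose dtgt (e : DE) : DN := Sub (tgt (val e)) (keepP _ _ (valP e) (or_intror erefl)).
pose D := @ab_graph (@Digraph DN DE dsrc dtgt) (fun e => elab (val e)).
pose dn b : node D := Sub (fnode m (fnode i b)) (keepi b).
pose d := @two_nodes_morphism D dn.
pose H := @ab_graph (@Digraph DN (option DE)
    (fun e => if e is Some e' then dsrc e' else dn false)
    (fun e => if e is Some e' then dtgt e' else dn true))
  (fun e => if e is Some e' then elab (val e') else lab_a).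
have lab1 (K K' : graph Sigma) (x : node K) (y : node K') : nlab x = nlab y.
  by case: (nlab x); case: (nlab y).
have csrc (e : edge D) : src (val e : edge G) = val (src e) by [].
have ctgt (e : edge D) : tgt (val e : edge G) = val (tgt e) by [].
pose c := @Morphism Sigma D G (DMorphism csrc ctgt) (fun=> lab1 _ _ _ _) (fun=> erefl).
have csrc' (e : edge D) : src (Some e : edge H) = src e by [].
have ctgt' (e : edge D) : tgt (Some e : edge H) = tgt e by [].
pose c' := @Morphism Sigma D H (@DMorphism D H id Some csrc' ctgt')
  (fun=> lab1 _ _ _ _) (fun=> erefl).
have msrc' (e : edge (P_ lab_a)) : src (None : edge H) = dn (src e) by [].
have mtgt' (e : edge (P_ lab_a)) : tgt (None : edge H) = dn (tgt e) by [].
pose m' := @Morphism Sigma (P_ lab_a) H (@DMorphism (P_ lab_a) H dn (fun=> None) msrc' mtgt')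
  (fun=> lab1 _ _ _ _) (fun=> erefl).
have dnI : injective dn by move=> b b' /(congr1 val) /= /mn/i_inj.
exists H, D, d, c, m', c'; split; apply: po_square_pushout.
- split=> //.
  + by move=> x y /val_inj.
  + by move=> x y /val_inj.
  + move=> b y /= by_; have /forallP/(_ b)/implyP : keepn (sval y) := valP y.
    rewrite -by_ eqxx => /(_ isT)/codomP[a ba]; exists a => //.
    by apply: val_inj; rewrite /= -by_ ba.
  + move=> b e /= be; have /andP[] : keepe (sval e) := valP e; rewrite -be.
    by case: (e12P b) => ->; rewrite ?eqxx.
  + move=> x; have [kx|/forallPn[z]] := boolP (keepn x).
      by right; exists (Sub x kx).
    by rewrite negb_imply => /andP[/eqP <- _]; left; exists z.
  + move=> e; have [ke|] := boolP (keepe e); first by right; exists (Sub e ke).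
    by rewrite negb_and !negbK => /orP[] /eqP ->; left; eexists.
- split=> //=.
  + by case=> [] [].
  + by move=> x y [].
  + by move=> b y <-; exists b.
  + by move=> x; right; exists x.
  + by move=> [e|]; [right; exists e|left; exists tt].
Qed.

End Derivations.

(** * Contractions preserve and reflect membership in the language *)

Section ContractionTheory.
Variables (L : graph Sigma) (i : morphism two_nodes L) (e1 e2 : edge L).
Variables (G H : graph Sigma) (m : morphism L G).
Variables (fn : node H -> node G) (fe : edge H -> edge G).
Hypothesis ctr : contraction i e1 e2 m fn fe.
Let src' := move_src (fedge m e2) (fnode m (fnode i false)).

Lemma contraction_edges : [set: edge G] :\ fedge m e1 = fe @: setT.
Proof.
apply/setP=> e; rewrite !inE andbT; apply/idP/imsetP => [|[d _ ->]].
  by case/(ctr_edges ctr)=> d <-; exists d.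
by apply/(ctr_edges ctr); exists d.
Qed.

Lemma contraction_card : #|edge G| = #|edge H|.+1.
Proof.
rewrite -cardsT (cardsD1 (fedge m e1)) inE add1n contraction_edges.
by rewrite (card_imset _ (ctr_inje ctr)) cardsT.
Qed.

Lemma contraction_sp s t :
  sp (@src H) (@tgt H) setT s t <->
  sp src' (@tgt G) (setT :\ fedge m e1) (fn s) (fn t).
Proof.
split=> [spH|spG].
  rewrite contraction_edges; apply: (sp_imset spH).
  - by move=> e _; apply: ctr_src ctr _.
  - by move=> e _; apply: ctr_tgt ctr _.
  - by move=> x y _ _; apply: ctr_injn ctr _ _.
  - by move=> x y _ _; apply: ctr_inje ctr _ _.
have -> : [set: edge H] = fe @^-1: (setT :\ fedge m e1).
  by apply/setP=> e; rewrite contraction_edges inE inE imset_f.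
apply: sp_preimset spG.
- exact: ctr_injn ctr.
- exact: ctr_inje ctr.
- exact: ctr_src ctr.
- exact: ctr_tgt ctr.
- by move=> e; rewrite contraction_edges => /imsetP[d _ ->]; apply: codom_f.
Qed.

Lemma contraction_incident x :
  incident (@src H) (@tgt H) setT x =
  incident src' (@tgt G) (setT :\ fedge m e1) (fn x).
Proof.
rewrite contraction_edges; apply/incidentP/idP => [[e _ ex]|].
  apply/incidentP; exists (fe e); first by rewrite imset_f.
  by rewrite /src' (ctr_src ctr) (ctr_tgt ctr); case: ex => ->; auto.
move/(incident_imset (src1 := @src H) (tgt1 := @tgt H) (fn := fn)).
case=> [e _|e _|y /incidentP[e eS ey] /(ctr_injn ctr) ->]; last by exists e.
  exact: ctr_src ctr e.
exact: ctr_tgt ctr e.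
Qed.

End ContractionTheory.

Lemma series_contraction_sp (x y : ab) (G H : graph Sigma)
    (m : morphism (path_graph x y) G) fn fe :
  dmorph_inj m ->
  contraction (@two_nodes_morphism (path_graph x y) Some) false true m
    (H := H) fn fe ->
  labelled_sp G <-> labelled_sp H.
Proof.
move=> [mn m_e] ctr; set e1 := fedge m false; set e2 := fedge m true.
set p := fnode m (Some false); set v := fnode m None; set q := fnode m (Some true).
have s1 : src e1 = p by rewrite src_morph.
have t1 : tgt e1 = v by rewrite tgt_morph.
have s2 : src e2 = v by rewrite src_morph.
have t2 : tgt e2 = q by rewrite tgt_morph.
have ne21 : e2 != e1 by rewrite (inj_eq m_e).
have vi : (None : node (path_graph x y)) \notin
    codom (fnode (@two_nodes_morphism (path_graph x y) Some)).
  by apply/codomP=> -[].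
have eO e : src e = v \/ tgt e = v -> e = e1 \/ e = e2.
  exact: ctr_dangling ctr _ e vi.
pose src' := move_src e2 p.
have src'e2 : src' e2 = src e1 by rewrite /src' /move_src eqxx s1.
have src'E e : e != e2 -> src' e = src e by rewrite /src' /move_src => /negPf ->.
(* Only the middle node is deleted. *)
have image z : z != v -> exists w, fn w = z.
  move=> /eqP zv; apply/(ctr_nodes ctr) => -[b|/esym //] _.
  exact: codom_f (fnode (@two_nodes_morphism (path_graph x y) Some)) b.
have fnv w : fn w <> v.
  move=> wv; have /(ctr_nodes ctr)/(_ None) : exists w, fn w = v by exists w.
  by move=> /(_ erefl) h; rewrite h in vi.
split=> [[s [t /series_parallelP[spG incG]]]|[s [t /series_parallelP[spH incH]]]].
(* The terminals survive: [e1] enters [v] and [e2] leaves it, so [v] is neither source nor sink. *)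
- have [s0 fs] : exists w, fn w = s.
    by apply: image; apply/eqP=> sv; apply: (sp_source_no_in spG (e := e1)); rewrite // t1.
  have [t0 ft] : exists w, fn w = t.
    by apply: image; apply/eqP=> tv; apply: (sp_sink_no_out spG (e := e2)); rewrite // s2.
  exists s0, t0; apply/series_parallelP; split.
    apply/(contraction_sp ctr); rewrite fs ft.
    apply: (sp_contract_series spG _ src'e2 src'E); split; rewrite ?inE // ?t1 //.
    by move=> e _; apply: eO.
  move=> w; rewrite (contraction_incident ctr); have /incidentP[e _ ew] := incG (fn w).
  (* If the witness is the deleted edge [e1], its source is the moved source of [e2], and its target
     [v] is no node of [H]. *)
  apply/incidentP; have [ee1|ne1] := eqVneq e e1.
    exists e2; first by rewrite !inE ne21.
    move: ew; rewrite ee1 t1 -src'e2 => -[]; first by left.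
    by move/esym/fnv.
  exists e; first by rewrite !inE ne1.
  have [ee2|ne2] := eqVneq e e2; last by rewrite -/e2 -/p -/src' src'E.
  by move: ew; rewrite ee2 s2 => -[/esym/fnv|]; auto.
- exists (fn s), (fn t); apply/series_parallelP; split.
    have /(contraction_sp ctr) spG := spH.
    have -> : [set: edge G] = e1 |: (setT :\ e1) by rewrite setD1K ?inE.
    apply: (sp_expand_series spG (e2 := e2)); rewrite ?inE ?eqxx ?ne21 //.
    + by rewrite t1.
    + apply/negP; rewrite (contraction_edges ctr).
      move/(incident_imset (src1 := @src H) (tgt1 := @tgt H) (fn := fn)).
      case=> [e _|e _|w _]; [exact: ctr_src ctr e|exact: ctr_tgt ctr e|].
      by rewrite t1 => /esym/fnv.
  move=> z; apply/incidentP; have [->|/image[w <-]] := eqVneq z v.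
    by exists e1; rewrite ?inE //; right.
  have := incH w; rewrite (contraction_incident ctr) => /incidentP[e _].
  have [->|ne2] := eqVneq e e2; last by rewrite -/e2 -/p -/src' src'E //; exists e; rewrite ?inE.
  rewrite -/e2 -/p -/src' src'e2 => -[]; first by exists e1; rewrite ?inE //; left.
  by exists e2; rewrite ?inE //; right.
Qed.

Lemma parallel_contraction_sp (x y : ab) (G H : graph Sigma)
    (m : morphism (parallel_graph x y) G) fn fe :
  dmorph_inj m ->
  contraction (@two_nodes_morphism (parallel_graph x y) id) false true m
    (H := H) fn fe ->
  labelled_sp G <-> labelled_sp H.
Proof.
move=> [mn m_e] ctr; set e1 := fedge m false; set e2 := fedge m true.
have s12 : src e1 = src e2 by rewrite !src_morph.
have t12 : tgt e1 = tgt e2 by rewrite !tgt_morph.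
have ne21 : e2 != e1 by rewrite (inj_eq m_e).
pose src' := move_src e2 (fnode m false).
(* Moving the source changes nothing here, because the two edges already share it. *)
have src'E e : src' e = src e.
  by rewrite /src' /move_src; case: eqP => // ->; rewrite src_morph.
have image z : exists w, fn w = z.
  apply/(ctr_nodes ctr) => b _.
  exact: codom_f (fnode (@two_nodes_morphism (parallel_graph x y) id)) b.
split=> [[s [t /series_parallelP[spG incG]]]|[s [t /series_parallelP[spH incH]]]].
- have [s0 fs] := image s; have [t0 ft] := image t.
  exists s0, t0; apply/series_parallelP; split.
    apply/(contraction_sp ctr); rewrite fs ft.
    apply: (eq_sp (src := @src G)) => [e _|]; first exact/esym/src'E.
    apply: (sp_contract_parallel (e1 := e2) spG); split; rewrite ?inE //.
    exact/eqP.
  move=> w; rewrite (contraction_incident ctr); have /incidentP[e _ ew] := incG (fn w).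
  apply/incidentP; have [ee1|ne1] := eqVneq e e1.
    exists e2; first by rewrite !inE ne21.
    by rewrite -/e2 [move_src _ _ _]src'E -s12 -t12 -ee1.
  by exists e; [rewrite !inE ne1|rewrite [move_src _ _ _]src'E].
- exists (fn s), (fn t); apply/series_parallelP; split.
    have /(contraction_sp ctr) spG := spH.
    have -> : [set: edge G] = e1 |: (setT :\ e1) by rewrite setD1K ?inE.
    apply: (sp_expand_parallel (e1 := e2)); rewrite ?inE ?eqxx ?ne21 //.
    by apply: eq_sp spG => e _; apply: src'E.
  move=> z; apply/incidentP; have [w <-] := image z.
  have := incH w; rewrite (contraction_incident ctr) => /incidentP[e _].
  by rewrite [move_src _ _ _]src'E; exists e; rewrite ?inE.
Qed.

(** * Steps of the system *)

Lemma step_cases (G H : graph Sigma) :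
  step sp_system G H ->
  exists x y, direct_derivation (s_rule x y) G H \/
              direct_derivation (p_rule x y) G H.
Proof.
case=> r [rS der]; move: rS der; rewrite /sp_system /=.
by do 7?[case=> [<-|]; first by (do 2!eexists); (left; eassumption) || (right; eassumption)].
Qed.

Lemma step_series (x y : ab) (G H : graph Sigma) :
  direct_derivation (s_rule x y) G H -> step sp_system G H.
Proof. by move=> der; exists (s_rule x y); split=> //; case: x {der}; case: y => /=; tauto. Qed.

(** The mixed parallel rule is listed only in the order a, b. *)
Lemma step_parallel (x y : ab) (G H : graph Sigma) :
  ~ (x = lab_b /\ y = lab_a) ->
  direct_derivation (p_rule x y) G H -> step sp_system G H.
Proof.
move=> xy der; exists (p_rule x y); split=> //; case: x y xy {der} => [] [] /=; tauto.
Qed.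

Lemma step_inv (G H : graph Sigma) :
  step sp_system G H ->
  [/\ labelled_sp G <-> labelled_sp H, #|edge G| = #|edge H|.+1 &
      exists e : edge H, elab e = lab_a].
Proof.
move=> /step_cases[x [y []]] [m [D [d [c [m' [c' [mI po1 po2]]]]]]].
  have [||||fn [fe ctr]] := @derivation_contraction (path_graph x y)
    (incl_l (s_rule x y)) false true _ _ _ _ G D H m d c m' c' mI po1 po2.
  - by move=> a b [].
  - by [].
  - by case; auto.
  - by [].
  split; [exact: series_contraction_sp mI ctr|exact: contraction_card ctr|].
  exact: ctr_lab ctr.
have [||||fn [fe ctr]] := @derivation_contraction (parallel_graph x y)
  (incl_l (p_rule x y)) false true _ _ _ _ G D H m d c m' c' mI po1 po2.
- by move=> a b.
- by [].
- by case; auto.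
- by [].
split; [exact: parallel_contraction_sp mI ctr|exact: contraction_card ctr|].
exact: ctr_lab ctr.
Qed.

Lemma parallel_step (G : graph Sigma) (e1 e2 : edge G) :
  e1 <> e2 -> src e1 = src e2 -> tgt e1 = tgt e2 -> src e1 <> tgt e1 ->
  ~ (elab e1 = lab_b /\ elab e2 = lab_a) -> exists H, step sp_system G H.
Proof.
move=> ne12 s12 t12 st ab; pose L := parallel_graph (elab e1) (elab e2).
pose mn (b : node L) := if b then tgt e1 else src e1.
pose me (b : edge L) := if b then e2 else e1.
have msrc e : src (me e) = mn (src e) by case: e.
have mtgt e : tgt (me e) = mn (tgt e) by case: e.
have mnl x : nlab (mn x) = nlab x by case: (nlab _).
have mel e : elab (me e) = elab e by case: e.
pose m := @Morphism Sigma L G (DMorphism msrc mtgt) mnl mel.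
have mI : dmorph_inj m.
  by split=> [] [] [] //= /esym // /esym.
have [|||H [D [d [c [m' [c' [po1 po2]]]]]]] := @contraction_exists L
  (incl_l (p_rule (elab e1) (elab e2))) false true _ _ G m mI.
- by [].
- by case; auto.
(* All nodes of the left-hand side are interface nodes, so the dangling condition is vacuous. *)
- by move=> z e; rewrite codom_f.
exists H; apply: (step_parallel ab).
by exists m, D, d, c, m', c'.
Qed.

Lemma series_step (G : graph Sigma) (e1 e2 : edge G) :
  tgt e1 = src e2 -> src e1 <> tgt e1 -> src e2 <> tgt e2 -> src e1 <> tgt e2 ->
  (forall e, src e = tgt e1 \/ tgt e = tgt e1 -> e = e1 \/ e = e2) ->
  exists H, step sp_system G H.
Proof.
move=> e12 ne1 ne2 ne3 eO; pose L := path_graph (elab e1) (elab e2).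
pose mn (b : node L) :=
  match b with None => tgt e1 | Some false => src e1 | Some true => tgt e2 end.
pose me (b : edge L) := if b then e2 else e1.
have msrc e : src (me e) = mn (src e) by case: e.
have mtgt e : tgt (me e) = mn (tgt e) by case: e.
have mnl x : nlab (mn x) = nlab x by case: (nlab _).
have mel e : elab (me e) = elab e by case: e.
pose m := @Morphism Sigma L G (DMorphism msrc mtgt) mnl mel.
have ne12 : e1 <> e2 by move=> ee; apply: ne1; rewrite e12 ee.
have ne2' : tgt e1 <> tgt e2 by rewrite e12.
have mI : dmorph_inj m.
  by split=> [[[]|] [[]|]|[] []] //= /esym.
have [|||H [D [d [c [m' [c' [po1 po2]]]]]]] := @contraction_exists L
  (incl_l (s_rule (elab e1) (elab e2))) false true _ _ G m mI.
- by move=> a b [].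
- by case; auto.
- move=> [b|] e; last by move=> _; apply: eO.
  by rewrite (codom_f (fnode (incl_l (s_rule (elab e1) (elab e2)))) b).
exists H; apply: step_series.
by exists m, D, d, c, m', c'.
Qed.

Lemma labelled_sp_step (G : graph Sigma) :
  labelled_sp G -> 1 < #|edge G| -> exists H, step sp_system G H.
Proof.
move=> [s [t /series_parallelP[spG _]]]; rewrite -cardsT => /(sp_has_redex spG).
case=> -[e1 [e2]].
  move=> [_ _ ne12 s12 t12]; have st := sp_loopless spG (in_setT e1).
  have [/andP[/eqP l1 /eqP l2]|l12] := boolP ((elab e1 == lab_b) && (elab e2 == lab_a)).
    (* Swapping the two edges brings the labels into the order of the rule. *)
    apply: (@parallel_step G e2 e1); rewrite -?s12 -?t12 // ?l1 ?l2; last by case.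
    by move/esym.
  by apply: (@parallel_step G e1 e2) => // -[l1 l2]; rewrite l1 l2 !eqxx in l12.
move=> [[_ _ e12 eO] ne]; apply: (@series_step G e1 e2) => //.
- exact: sp_loopless spG (in_setT e1).
- exact: sp_loopless spG (in_setT e2).
- by move=> e; apply: eO; rewrite inE.
Qed.

(** * Recognition, termination and confluence *)

Lemma derives_step (G H K : graph Sigma) :
  step sp_system G H -> derives sp_system H K -> derives sp_system G K.
Proof.
move=> GH [HK|HK]; right; first by apply: t_step; apply: step_iso HK.
by apply: t_trans HK; apply: t_step.
Qed.

(** No node is isolated, so the only nodes are the two distinct ends of [e]. *)
Lemma labelled_sp_one_edge (G : graph Sigma) (e : edge G) :
  labelled_sp G -> #|edge G| <= 1 -> isomorphic G (P_ (elab e)).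
Proof.
move=> [s [t /series_parallelP[spG incG]]] /card_le1_eqP edge1.
have {}edge1 e' : e' = e by apply: edge1.
have /eqP/negPf st := sp_loopless spG (in_setT e).
pose fn (b : node (P_ (elab e))) := if b then tgt e else src e.
have fsrc (u : edge (P_ (elab e))) : src e = fn (src u) by [].
have ftgt (u : edge (P_ (elab e))) : tgt e = fn (tgt u) by [].
have fnl x : nlab (fn x) = nlab x by case: (nlab _).
apply: isomorphic_sym.
exists (@Morphism Sigma _ G (@DMorphism (P_ (elab e)) G fn (fun=> e) fsrc ftgt)
          fnl (fun=> erefl)).
split; last by exists (fun=> tt) => [[]|e'] //=.
exists (fun x => x == tgt e) => [[]|x] /=; rewrite ?eqxx ?st //.
have /incidentP[e' _] := incG x; rewrite /fn (edge1 e').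
by case=> <-; rewrite ?eqxx ?st.
Qed.

(** The disjunction excludes just the single b-labelled edge and is restored by every step, which
    creates an a-labelled edge. Each step removes one edge, so induction on their number ends at one
    edge labelled a. *)
Lemma derives_P_a (G : graph Sigma) :
  labelled_sp G -> 1 < #|edge G| \/ (exists e : edge G, elab e = lab_a) ->
  derives sp_system G (P_ lab_a).
Proof.
have [n] := ubnP #|edge G|; elim: n G => // n IH G leG spG.
have [gt1 _|le1 []//] := ltnP 1 #|edge G|; last first.
  by case=> e <-; left; apply: labelled_sp_one_edge.
have [H GH] := labelled_sp_step spG gt1.
have [spGH cardG a_edge] := step_inv GH; apply: (derives_step GH).
by apply: IH; [rewrite -ltnS -cardG|apply/spGH|right].
Qed.

Lemma derives_sp (G H : graph Sigma) :
  derives sp_system G H -> labelled_sp G <-> labelled_sp H.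
Proof.
case=> [GH|].
  by split; apply: labelled_sp_iso => //; apply: isomorphic_sym.
by elim=> {G H} [G H /step_inv[]//|G H K _ -> _ ->].
Qed.

Lemma labelled_sp_P x : labelled_sp (P_ x).
Proof. by exists false, true; apply: sp_edge. Qed.

Lemma sp_system_recognises :
  recognises sp_system [:: P_ lab_a; P_ lab_b] (labelled_series_parallel Sigma).
Proof.
move=> G; split=> [spG|[P [PS /derives_sp GP]]]; last first.
  by apply/GP; case: PS => [<-|[<-|[]]]; apply: labelled_sp_P.
have [gt1|le1] := ltnP 1 #|edge G|.
  by exists (P_ lab_a); split; [left|apply: derives_P_a => //; left].
have [s [t /series_parallelP[/sp_has_src[e _ _] _]]] := spG.
exists (P_ (elab e)); split; last by left; apply: labelled_sp_one_edge.
by case: (elab e) => /=; auto.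
Qed.

Lemma sp_system_terminating : terminating sp_system.
Proof.
case=> G steps; have bound n : #|edge (G n)| + n = #|edge (G 0)|.
  elim: n => [|n <-]; first by rewrite addn0.
  by have [_ -> _] := step_inv (steps n); rewrite addSnnS.
(* At this index the second summand alone exceeds the right-hand side. *)
have := bound #|edge (G 0)|.+1; move/eqP; rewrite addnS -addSn.
by rewrite -[X in _ == X]add0n eqn_add2r.
Qed.

Lemma isomorphic_card (G H : graph Sigma) :
  isomorphic G H -> #|edge G| = #|edge H|.
Proof. by case=> f [_ fe]; apply: bij_eq_card fe. Qed.

Lemma sp_system_confluent :
  confluent_on sp_system (labelled_series_parallel Sigma).
Proof.
move=> G H1 H2 spG.
(* A step leaves at least the created edge, so its starting graph has at least two. *)
have trans_inv H : clos_trans _ (step sp_system) G H ->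
    1 < #|edge G| /\ exists e : edge H, elab e = lab_a.
  elim=> {G spG H} [G H GH|G H K _ [gt1 _] _ [_ ?]]; last by [].
  have [_ cardG [e eE]] := step_inv GH; split; last by exists e.
  by rewrite cardG ltnS; apply/card_gt0P; exists e.
have [gt1|le1] := ltnP 1 #|edge G|.
  have toP H : derives sp_system G H -> derives sp_system H (P_ lab_a).
    move=> GH; apply: derives_P_a; first by apply/(derives_sp GH).
    by case: GH => [/isomorphic_card <-|/trans_inv[]]; auto.
  by move=> /toP ? /toP ?; exists (P_ lab_a).
(* With at most one edge no step applies, and isomorphic copies are joined at [G] itself. *)
have only_iso H : derives sp_system G H -> isomorphic G H.
  by case=> // /trans_inv[]; rewrite ltnNge le1.
move=> /only_iso GH1 /only_iso GH2; exists G.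
by split; left; apply: isomorphic_sym.
Qed.

Theorem mainTheorem13 :
  backtracking_free_specification sp_system [:: P_ lab_a; P_ lab_b]
    (labelled_series_parallel Sigma).
Proof.
split.
- exact: sp_system_recognises.
- exact: sp_system_terminating.
- exact: sp_system_confluent.
Qed.
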